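(* Let $\mathbb{E}$ be a finite-dimensional real vector space (total space), $\mathbb{E}_\vee$ a subspace (physical space) and $\Gamma\subset\mathbb{E}$ a full rank lattice, with the image $[\mathbb{E}_\vee]$ of $\mathbb{E}_\vee$ dense in $\mathbb{T}=\mathbb{E}/\Gamma$ and $\Gamma\cap\mathbb{E}_\vee=\{\mathbf{0}\}$. The following are equivalent: (1) there is an internal space $\mathbb{E}_<$, an expansive linear map $L\colon\mathbb{E}_\vee\to\mathbb{E}_\vee$, and a window $W$ so that the cut and project set corresponding to $W$ and the scheme $\mathcal{S}=(\mathbb{E},\mathbb{E}_\vee,\mathbb{E}_<,\Gamma)$ is $L$-Sub; (2) there exists a hyperbolic linear automorphism $M\colon\mathbb{E}\to\mathbb{E}$, with $M(\Gamma)=\Gamma$, for which $\mathbb{E}_\vee$ is $M$-invariant, and $M|_{\mathbb{E}_\vee}$ is expansive. In this case, $L=M|_{\mathbb{E}_\vee}$ and $\mathbb{E}_<$ is the contracting subspace of $M$, with $A=M|_{\mathbb{E}_<}$. Moreover, there is a finite collection of lattice points $Z\subset\Gamma$ and such a window $W$ (that is, a window as in (1)), invariant in the sense that $$W=\bigcup_{z\in Z}\bigl(A(W)+z_<\bigr).$$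
   Context: **Patterns.** A Delone multiset in a finite-dimensional real normed space $E$ is a tuple $\Lambda=(\Lambda_1,\dots,\Lambda_\ell)$ of subsets of $E$ whose union is uniformly discrete and relatively dense (a Delone set when $\ell=1$). Translates and linear images $L\Lambda$ are taken componentwise. A patch of $\Lambda$ is a tuple $(\Lambda_i\cap U)_i$ with $U$ bounded. With $B(x,r)$ the closed ball, $\Lambda[x,r]:=((\Lambda_i\cap B(x,r))-x)_i$. $\mathcal{Q}$ is locally derivable (LD) from $\mathcal{P}$ if there is $c\ge0$ such that for all $x,y\in E$, $\mathcal{P}[x,c]=\mathcal{P}[y,c]$ implies $\mathcal{Q}[x,0]=\mathcal{Q}[y,0]$; they are MLD if each is LD from the other. $\mathcal{P}$ is locally indistinguishable (LI) from $\mathcal{Q}$ if every patch of $\mathcal{P}$ occurs, up to translation, in $\mathcal{Q}$; they are locally isomorphic if each is LI from the other. The hull $\Omega_{\mathcal{P}}$ is the set of all patterns LI from $\mathcal{P}$. For a linear automorphism $L$ of $E$, $\mathcal{P}$ is $L$-Sub (strongly $L$-substitutional) if there is $\mathcal{P}'$, locally isomorphic to $\mathcal{P}$, with $L\mathcal{P}'$ and $\mathcal{P}$ MLD. A linear map is expansive (contractive) if all its eigenvalues have modulus strictly greater (less) than $1$. A linear automorphism $M$ of $\mathbb{E}$ is hyperbolic if $\mathbb{E}$ is the sum of two $M$-invariant subspaces, with $M$ expansive on one and contractive on the other; the latter is the contracting subspace of $M$. **Cut and project.** A cut and project scheme $\mathcal{S}=(\mathbb{E},\mathbb{E}_\vee,\mathbb{E}_<,\Gamma)$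 consists of a $k$-dimensional real vector space $\mathbb{E}$, complementary subspaces $\mathbb{E}_\vee$ (physical space) of dimension $d>0$ and $\mathbb{E}_<$ (internal space) of dimension $k-d>0$, and a full rank lattice $\Gamma\subset\mathbb{E}$. Write $x_\vee,x_<$ for the projections of $x$ to $\mathbb{E}_\vee,\mathbb{E}_<$ along $\mathbb{E}=\mathbb{E}_\vee\oplus\mathbb{E}_<$ (similarly for sets). It is required that $\gamma\mapsto\gamma_\vee$ and $\gamma\mapsto\gamma_<$ are injective on $\Gamma$ and $\Gamma_<$ is dense in $\mathbb{E}_<$. A window is a finite tuple $W=(W_i)_{i=1}^\ell$ of compact, topologically regular (equal to the closure of their interior) subsets of $\mathbb{E}_<$, not all empty; if $\ell=1$ it is single-coloured and identified with $W_1$. It is non-singular if $\Gamma_<\cap\partial W_i=\emptyset$ for all $i$; then the cut and project set is $\Lambda(\mathcal{S},W)=(\Lambda_i)_i$ with $\Lambda_i=\{\gamma_\vee:\gamma\in\Gamma,\ \gamma_<\in W_i\}$. For arbitrary $W$, $\Omega(\mathcal{S},W):=\Omega_{\Lambda(\mathcal{S},W+s)}$ for any $s\in\mathbb{E}_<$ with $W+s$ non-singular (independent of $s$); its elements are the cut and project sets corresponding to $W$ and $\mathcal{S}$. They are all locally isomorphic to each other, so one of them is $L$-Sub if and only if all are.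
   Formalization: Condition (2) additionally requires that the physical space and the contracting subspace of M together span the total space, i.e. that the physical space is the whole expanding subspace of M; without this, (2) does not imply (1). *)

(* Defs.v *)
From HB Require Import structures.
From mathcomp Require Import all_boot all_order all_algebra.
From mathcomp Require Import generic_quotient ring_quotient.
From mathcomp Require Import all_classical all_reals all_analysis.
From mathcomp Require Import complex.

Set Implicit Arguments.
Unset Strict Implicit.
Unset Printing Implicit Defensive.

Import Order.TTheory GRing.Theory Num.Theory.
Import numFieldNormedType.Exports.

Local Open Scope classical_set_scope.
Local Open Scope ring_scope.

Section SubspaceNorm.
Variables (R : realType) (k : nat) (U : {vspace 'rV[R]_k}).

Definition subspace_norm (u : subvs_of U) : R := `|vsval u|.

Lemma subspace_normD (u v : subvs_of U) :
  subspace_norm (u + v) <= subspace_norm u + subspace_norm v.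
Proof. by rewrite /subspace_norm linearD ler_normD. Qed.

Lemma subspace_normZ (a : R) (u : subvs_of U) :
  subspace_norm (a *: u) = `|a| * subspace_norm u.
Proof. by rewrite /subspace_norm linearZ normrZ. Qed.

Lemma subspace_norm0_eq0 (u : subvs_of U) : subspace_norm u = 0 -> u = 0.
Proof. by move/normr0_eq0 => u0; apply/val_inj; rewrite /= u0. Qed.

(* Makes [subvs_of U] a [normedModType], hence a topological space.  None of
   the notions below depends on the choice of the norm. *)
HB.instance Definition _ := @Lmodule_isNormed.Build R (subvs_of U)
  subspace_norm subspace_normD subspace_normZ subspace_norm0_eq0.

End SubspaceNorm.

Section Patterns.
Variables (R : realType) (V : normedModType R).

Definition multiset (l : nat) := 'I_l -> set V.

Definition translate (A : set V) (t : V) : set V := [set a + t | a in A].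

Definition support l (P : multiset l) : set V := \bigcup_i P i.

Definition uniformly_discrete (A : set V) :=
  exists2 r : R, 0 < r & forall x y, A x -> A y -> x != y -> r <= `|x - y|.

Definition relatively_dense (A : set V) :=
  exists r : R, forall x, exists2 y, A y & `|x - y| <= r.

Definition delone l (P : multiset l) :=
  uniformly_discrete (support P) /\ relatively_dense (support P).

(* [closed_ball_] is [[set y | `|x - y| <= r]], so that the ball of radius 0 is
   a singleton; the library's [closed_ball x 0] is empty. *)
Definition local_patch l (P : multiset l) (x : V) (r : R) : multiset l :=
  fun i => translate (P i `&` closed_ball_ (fun v : V => `|v|) x r) (- x).

Definition locally_derivable l m (Q : multiset m) (P : multiset l) :=
  exists2 c : R, 0 <= c &
    forall x y, local_patch P x c = local_patch P y c ->
                local_patch Q x 0 = local_patch Q y 0.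

Definition MLD l m (P : multiset l) (Q : multiset m) :=
  locally_derivable Q P /\ locally_derivable P Q.

(* A patch on [U] occurs in [Q] when it is a translate of the patch of [Q] on
   the correspondingly translated region: points of [Q] in that region that are
   not in the patch are excluded. *)
Definition LI l (P Q : multiset l) :=
  forall U : set V, bounded_set U ->
    exists t : V, forall i,
      translate (P i `&` U) t = Q i `&` translate U t.

Definition locally_isomorphic l (P Q : multiset l) := LI P Q /\ LI Q P.

Definition hull l (P : multiset l) : set (multiset l) :=
  [set Q | delone Q /\ LI Q P].

Definition image_multiset (L : V -> V) l (P : multiset l) : multiset l :=
  fun i => L @` P i.

Definition L_Sub (L : V -> V) l (P : multiset l) :=
  bijective L /\
  exists P' : multiset l,
    [/\ delone P', locally_isomorphic P' P & MLD (image_multiset L P') P].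

End Patterns.

Section LinearMaps.
Variable R : realType.

Section Eigenvalues.
Variable V : vectType R.

(* Eigenvalues of the complexification of [f]. *)
Definition complex_eigenvalue (f : 'End(V)) (z : R[i]) : bool :=
  eigenvalue (map_mx (real_complex R) (passmx.mxof (vbasis {:V}) (vbasis {:V}) f)) z.

Definition expansive (f : 'End(V)) :=
  forall z, complex_eigenvalue f z -> 1 < `|z|.

Definition contractive (f : 'End(V)) :=
  forall z, complex_eigenvalue f z -> `|z| < 1.

Definition invariant_subspace (M : 'End(V)) (U : {vspace V}) : bool :=
  (M @: U <= U)%VS.

(* The restriction of [M] to [U], meaningful when [U] is [M]-invariant. *)
Definition restr (U : {vspace V}) (M : 'End(V)) : 'End(subvs_of U) :=
  linfun (vsproj U \o M \o vsval).

End Eigenvalues.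

Section Hyperbolic.
Variable V : vectType R.

Definition hyperbolic_splitting (M : 'End(V)) (U S : {vspace V}) :=
  [/\ (U + S)%VS = fullv, invariant_subspace M U /\ invariant_subspace M S,
      expansive (restr U M) & contractive (restr S M)].

Definition hyperbolic (M : 'End(V)) :=
  bijective M /\ exists U S, hyperbolic_splitting M U S.

Definition contracting_subspace (M : 'End(V)) (S : {vspace V}) :=
  exists U, hyperbolic_splitting M U S.

End Hyperbolic.
End LinearMaps.

Section CutAndProject.
Variables (R : realType) (k : nat).
Local Notation E := 'rV[R]_k.

Definition full_rank_lattice (G : zmodClosed E) :=
  exists2 b : (\dim {:E}).-tuple E, basis_of fullv b &
    forall x, x \in G <->
      exists a : 'I_(\dim {:E}) -> int, x = \sum_(i < \dim {:E}) b`_i *~ a i.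

Definition torus (G : zmodClosed E) : topologicalType :=
  quotient_topology (Quotient.quot G).

Definition torus_proj (G : zmodClosed E) : E -> torus G :=
  \pi_(quotient_topology (Quotient.quot G))%qT.

Variables (Ev Ei : {vspace E}) (G : zmodClosed E).

(* [x_vee] and [x_<]: the projections along [E = Ev (+) Ei]. *)
Definition phys_proj (x : E) : subvs_of Ev := vsproj Ev (daddv_pi Ev Ei x).
Definition int_proj (x : E) : subvs_of Ei := vsproj Ei (daddv_pi Ei Ev x).

Record cut_project_scheme : Prop := {
  scheme_phys_dim : (0 < \dim Ev)%N;
  scheme_int_dim : (0 < \dim Ei)%N;
  scheme_complementary : (Ev + Ei)%VS = fullv /\ (Ev :&: Ei)%VS = 0%VS;
  scheme_lattice : full_rank_lattice G;
  scheme_phys_inj : {in G &, injective phys_proj};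
  scheme_int_inj : {in G &, injective int_proj};
  scheme_int_dense : dense (int_proj @` [set` G])
}.

Definition is_window l (W : 'I_l -> set (subvs_of Ei)) :=
  (forall i, compact (W i) /\ W i = closure (interior (W i))) /\
  exists i, W i !=set0.

Definition shift_window l (W : 'I_l -> set (subvs_of Ei)) (s : subvs_of Ei) :
  'I_l -> set (subvs_of Ei) := fun i => translate (W i) s.

Definition nonsingular l (W : 'I_l -> set (subvs_of Ei)) :=
  forall i, (int_proj @` [set` G]) `&` (closure (W i) `\` interior (W i)) = set0.

Definition cut_project_set l (W : 'I_l -> set (subvs_of Ei)) :
  multiset (subvs_of Ev) l :=
  fun i => [set phys_proj g | g in [set g | g \in G /\ W i (int_proj g)]].

(* All shifts [s] with [W + s] non-singular give the same hull. *)
Definition cut_project_hull l (W : 'I_l -> set (subvs_of Ei)) :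
  set (multiset (subvs_of Ev) l) :=
  [set P | exists s, nonsingular (shift_window W s) /\
                     hull (cut_project_set (shift_window W s)) P].

(* The elements of the hull are locally isomorphic to each other, so one of
   them is [L]-Sub if and only if all are. *)
Definition cut_project_L_Sub (L : 'End(subvs_of Ev))
    l (W : 'I_l -> set (subvs_of Ei)) :=
  exists2 P, cut_project_hull W P & L_Sub L P.

End CutAndProject.

Section Conditions.
Variables (R : realType) (k : nat).
Local Notation E := 'rV[R]_k.
Variables (Ev : {vspace E}) (G : zmodClosed E).

Definition substitutional_datum (Ei : {vspace E}) (L : 'End(subvs_of Ev))
    l (W : 'I_l -> set (subvs_of Ei)) :=
  [/\ cut_project_scheme Ev Ei G, expansive L, is_window W
    & cut_project_L_Sub G L W].

(* The last clause says that [Ev] is the whole expanding subspace of [M], i.e.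
   that the contracting subspace of [M] is an internal space for [Ev].
   Invariance of [Ev] and expansiveness of [M] on it do not imply this: take
   [K] a real quadratic field with a unit [u > 1], [G] the ring of integers of
   [K] squared in [R^2 x R^2] (one factor for each real embedding), [M] the
   multiplication by [u], and [Ev] a line of transcendental slope in the first
   factor. *)
Definition hyperbolic_datum (M : 'End(E)) :=
  [/\ hyperbolic M, M @` [set` G] = [set` G],
      invariant_subspace M Ev, expansive (restr Ev M)
    & exists2 S, contracting_subspace M S & (Ev + S)%VS = fullv].

End Conditions.

(* Main.v *)
Require Import Defs.
From HB Require Import structures.
From mathcomp Require Import all_boot all_order all_algebra.
From mathcomp Require Import generic_quotient ring_quotient.
From mathcomp Require Import all_classical all_reals all_analysis.
From mathcomp Require Import complex.
From mathcomp Require finmap.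
From mathcomp Require Import ring lra zify.

Set Implicit Arguments.
Unset Strict Implicit.
Unset Printing Implicit Defensive.

Import Order.TTheory GRing.Theory Num.Theory.
Import numFieldNormedType.Exports.

Local Open Scope classical_set_scope.
Local Open Scope ring_scope.

(* If a pattern is [L]-Sub, mutual local derivability turns return vectors of
   large patches into [L] and [L^-1] times return vectors of large patches.  By
   compactness the return vectors of patches of radius [r] have the form [g_vee]
   with [g] in the lattice and [g_<] of size tending to [0] as [r] grows, and
   conversely all [g] with [g_<] small enough occur and generate the lattice.
   Hence [L] permutes the projected lattice, which lifts to a linear [M], and the
   smallness of the internal parts forces [M] to preserve the physical space and
   to contract the internal one.

   Conversely every regular self-affine window [K = \bigcup_z (A K + z_<)] works.
   Rescaled by [M^-n], the pieces of level [n] of [K] that lie close to a given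
   piece differ from it by lattice vectors bounded in both components, so there
   are only finitely many neighbourhood types.  Thus some level [n + q] shows all
   types of level [n], so that [A^q K] agrees near each point with a lattice
   translate of [K] and is locally derivable from it; [A K] is a finite union of
   translates of [A^q K]. *)

(** * Topology of normed spaces *)

(** Nothing ties [L] to the lattice beforehand, so patterns are read only through return vectors,
    which depend neither on a position nor on the member of the local isomorphism class. Each use of
    local derivability costs a constant radius [c]. In a norm adapted to [L^-1], one expansion turns
    a radius [t] into [t / r - c], which grows without bound once [t] passes a threshold. A single
    step only bounds the internal part of the image; contraction comes from iterating, uniformly
    over a slab of lattice points. In the converse the delicate direction is to derive [A K] from
    [K], since invariance presents [K] as a union of translates of [A K] and not the reverse.
    Pigeonhole equates the neighbourhood types of two unspecified levels, hence a power [q] instead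
    of 1. The pattern and its partner [P'] have shifts [s] and [A^-1 s]; both must be non-singular
    at once, which is where Baire category enters. *)

Section NormTopology.
Variables (R : realType) (V : normedModType R).
Implicit Types (A B : set V) (x y : V).

Lemma interior_normP A x :
  interior A x <-> exists2 e : R, 0 < e & forall y, `|x - y| < e -> A y.
Proof. by split=> [/nbhs_normP|?]; last exact/nbhs_normP. Qed.

Lemma open_normP A :
  open A <-> forall x, A x -> exists2 e : R, 0 < e & forall y, `|x - y| < e -> A y.
Proof.
rewrite openE; split=> [oA x /oA /interior_normP//|oA x /oA ?]; exact/interior_normP.
Qed.

Lemma closure_normP A x :
  closure A x <-> forall e : R, 0 < e -> exists2 y, A y & `|x - y| < e.
Proof.
split=> [cA e e0|cA B /nbhs_normP[e e0 eB]].
  by have [y [Ay xy]] := cA _ (nbhsx_ballx x e e0); exists y; rewrite // -ball_normE in xy.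
by have [y Ay xy] := cA e e0; exists y; split=> //; exact: eB.
Qed.

Lemma closed_normP A :
  closed A <-> forall x, (forall e : R, 0 < e -> exists2 y, A y & `|x - y| < e) -> A x.
Proof.
by split=> cA x H; apply: cA; exact/closure_normP.
Qed.

Lemma dense_normP A :
  dense A <-> forall x (e : R), 0 < e -> exists2 y, A y & `|x - y| < e.
Proof.
split=> [dA x e e0|dA O [x Ox] /open_normP/(_ x Ox)[e e0 eO]].
  have [|y []] := dA _ _ (ball_open x e); first by exists x; exact: ballxx.
  by rewrite -ball_normE => xy Ay; exists y.
by have [y Ay xy] := dA x e e0; exists y; split=> //; exact: eO.
Qed.

Lemma bounded_set_normP A : bounded_set A <-> exists M : R, forall x, A x -> `|x| <= M.
Proof.
split=> [[M [_ HM]]|[M HM]]; last first.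
  exists M; split; first exact: num_real.
  by move=> N /ltW MN x Ax; exact: le_trans (HM _ Ax) MN.
by exists (M + 1); apply: HM; rewrite ltrDl.
Qed.

Lemma compact_norm_bounded A : compact A -> exists M : R, forall x, A x -> `|x| <= M.
Proof. by move/compact_bounded/bounded_set_normP. Qed.

Lemma compact_finite_cover A (I : choiceType) (D : set I) (f : I -> set V) :
  compact A -> (forall i, D i -> open (f i)) ->
  (forall x, A x -> exists2 i, D i & f i x) ->
  exists s : seq I, (forall i, i \in s -> D i) /\
                    (forall x, A x -> exists2 i, i \in s & f i x).
Proof.
rewrite compact_cover => cA of_ Af; have [|D' D'D AD'] := cA _ D f of_.
  by move=> x /Af[i Di fx]; exists i.
exists (finmap.enum_fset D'); split=> [i /D'D /set_mem//|x /AD'[i /= iD' fx]].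
by exists i.
Qed.

End NormTopology.

(** * Spectral bounds *)

(** Lets row vectors be recognised as a complete normed space, as [Baire] asks in
    [subspace_Baire]. *)
HB.instance Definition _ (R : realType) (m n : nat) := Complete.on 'M[R]_(m, n).

Section SpectralBounds.
Variable R : realType.
Local Notation normc := (@Normc.normc R).

Lemma normc_ge0 (z : R[i]) : 0 <= normc z.
Proof. by case: z => a b; exact: sqrtr_ge0. Qed.

Lemma norm_normc (z : R[i]) : `|z| = ((normc z)%:C)%C.
Proof. by rewrite normc_def; case: z. Qed.

Lemma normc_real (a : R) : normc (a%:C)%C = `|a|.
Proof. by rewrite /= expr0n addr0 sqrtr_sqr. Qed.

(** The sequence [c / (r - a) * r ^+ m] solves the recurrence with equality, and the homogeneous
    part grows at most like [a ^+ m]. *)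
Lemma affine_recurrence_bound (u : nat -> R) (a r c : R) :
  0 <= a -> a < r -> 0 <= c -> (forall m, 0 <= u m) ->
  (forall m, u m.+1 <= a * u m + c * r ^+ m) ->
  forall m, u m <= (u 0%N + c / (r - a)) * r ^+ m.
Proof.
move=> a0 ar c0 u0 urec; have ra : 0 < r - a by rewrite subr_gt0.
have q0 : 0 <= c / (r - a) by rewrite divr_ge0// ltW.
have r0 : 0 < r by lra.
elim=> [|m IH]; first by rewrite expr0 mulr1 lerDl.
apply: le_trans (urec m) _.
apply: (@le_trans _ _ (a * ((u 0%N + c / (r - a)) * r ^+ m) + c * r ^+ m)).
  by rewrite lerD2r ler_wpM2l.
rewrite exprS mulrA mulrA -mulrDl; apply: ler_wpM2r; first exact: exprn_ge0 (ltW r0).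
have -> : (u 0%N + c / (r - a)) * r =
  a * (u 0%N + c / (r - a)) + c + u 0%N * (r - a).
  by field; rewrite gt_eqF.
by rewrite lerDl mulr_ge0 // ltW.
Qed.

(** Replaces the Jordan form by induction on the roots: [v *m (B - z%:M)] is killed by the remaining
    factors, and [v B^(m+1) = z v B^m + v (B - z) B^m]. The strict inequality with [r] absorbs the
    polynomial factors caused by repeated roots. *)
Lemma row_powers_decay n (B : 'M[R[i]]_n.+1) (r : R) (s : seq R[i]) :
  (forall z, z \in s -> normc z < r) ->
  forall v : 'rV_n.+1, v *m horner_mx B (\prod_(z <- s) ('X - z%:P)) = 0 ->
  exists2 C, 0 <= C & forall m j, normc ((v *m B ^+ m) 0 j) <= C * r ^+ m.
Proof.
elim: s => [|z s IH] sr v.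
  rewrite big_nil rmorph1 mulmx1 => ->; exists 0 => // m j.
  by rewrite mul0mx mxE Normc.normc0 mul0r.
rewrite big_cons rmorphM /= rmorphB /= horner_mx_X horner_mx_C mulmxA => v0.
have [y ys|C C0 HC] := IH _ _ v0; first by apply: sr; rewrite inE ys orbT.
have zr : normc z < r by apply: sr; rewrite mem_head.
exists (\sum_j normc (v 0 j) + C / (r - normc z)).
  by rewrite addr_ge0 ?sumr_ge0 ?divr_ge0 ?subr_ge0 ?(ltW zr)// => *; exact: normc_ge0.
move=> m j.
have r0 : 0 <= r := le_trans (normc_ge0 z) (ltW zr).
apply: (@le_trans _ _ ((normc (v 0 j) + C / (r - normc z)) * r ^+ m)); last first.
  apply: ler_wpM2r; first exact: exprn_ge0.
  by rewrite lerD2r (bigD1 j)//= lerDl sumr_ge0// => *; exact: normc_ge0.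
have -> : v 0 j = (v *m B ^+ 0) 0 j by rewrite expr0 mulmx1.
apply: (@affine_recurrence_bound (fun m => normc ((v *m B ^+ m) 0 j))) => //.
- exact: normc_ge0.
- by move=> ?; exact: normc_ge0.
move=> {}m; rewrite -Normc.normcM.
have -> : v *m B ^+ m.+1 = z *: (v *m B ^+ m) + v *m (B - z%:M) *m B ^+ m.
  by rewrite exprS mulmxA mulmxBr mulmxBl mul_mx_scalar -scalemxAl addrC subrK.
rewrite [X in normc X]mxE [X in normc (X + _)]mxE.
by apply: le_trans (le_normcD _ _) _; rewrite lerD2l.
Qed.

Lemma matrix_powers_decay n (B : 'M[R[i]]_n.+1) :
  (forall z, eigenvalue B z -> normc z < 1) ->
  exists2 r : R, 0 < r < 1 &
  forall v : 'rV_n.+1, exists2 C, 0 <= C &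
    forall m j, normc ((v *m B ^+ m) 0 j) <= C * r ^+ m.
Proof.
move=> eB; have [s ps] := closed_field_poly_normal (char_poly B).
rewrite (monicP (char_poly_monic B)) scale1r in ps.
have sB z : z \in s -> normc z < 1.
  by move=> zs; apply: eB; rewrite eigenvalue_root_char ps root_prod_XsubC.
have [r r01 sr] : exists2 r : R, 0 < r < 1 & forall z, z \in s -> normc z < r.
  elim: s sB {ps} => [|z s IH] sB; first by exists (1/2) => //; lra.
  have [y ys|r r01 sr] := IH; first by apply: sB; rewrite inE ys orbT.
  have z1 : normc z < 1 by apply: sB; rewrite mem_head.
  exists (Num.max r ((1 + normc z) / 2)).
    by rewrite lt_max gt_max; apply/andP; split; [apply/orP; left; lra|lra].
  move=> y; rewrite inE lt_max => /orP[/eqP ->|/sr ->//].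
  by apply/orP; right; lra.
exists r => // v; apply: (row_powers_decay sr).
by rewrite -ps Cayley_Hamilton mulmx0.
Qed.

(** Written with [iter] because powers of [B] need a size of the form [n.+1], while a subspace may
    have dimension 0. *)
Lemma matrix_orbit_decay n (B : 'M[R[i]]_n) :
  (forall z, eigenvalue B z -> normc z < 1) ->
  exists2 r : R, 0 < r < 1 &
  forall v : 'rV_n, exists2 C, 0 <= C &
    forall m j, normc ((iter m (fun w => w *m B) v) 0 j) <= C * r ^+ m.
Proof.
case: n B => [B _|n B /matrix_powers_decay[r r01 dec]].
  by exists (1/2) => [|v]; [lra|exists 0 => // m []].
exists r => // v; have [C C0 HC] := dec v; exists C => // m j.
suff -> : iter m (fun w => w *m B) v = v *m B ^+ m by [].
elim: m {HC} => [|m IH]; first by rewrite expr0 mulmx1.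
by rewrite iterS IH -mulmxA exprSr.
Qed.

Section OnSubspace.
Variables (k : nat) (U : {vspace 'rV[R]_k}).
Local Notation V := (subvs_of U).
Local Notation e := (vbasis {:V}).

Lemma sum_coord_vbasis (x : V) : x = \sum_i coord e i x *: e`_i.
Proof. exact: coord_vbasis (memvf x). Qed.

Lemma rVof_iter (f : 'End(V)) (x : V) m :
  passmx.rVof e (iter m f x) =
  iter m (fun v => v *m passmx.mxof e e f) (passmx.rVof e x).
Proof.
elim: m => //= m <-.
by rewrite (@passmx.rVof_app _ _ _ e e (vbasisP _)).
Qed.

Lemma contractive_orbit_decay (f : 'End(V)) : contractive f ->
  exists2 r : R, 0 < r < 1 &
  forall x, exists2 C, 0 <= C & forall m, `|iter m f x| <= C * r ^+ m.
Proof.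
move=> cf.
have [r r01 dec] : exists2 r : R, 0 < r < 1 &
    forall x : V, exists2 C, 0 <= C &
    forall m j, `|coord e j (iter m f x)| <= C * r ^+ m.
  pose B := map_mx (real_complex R) (passmx.mxof e e f).
  have eB z : eigenvalue B z -> normc z < 1.
    by move=> /cf; rewrite norm_normc -(ltcR (normc z) 1).
  have itE x m : map_mx (real_complex R) (passmx.rVof e (iter m f x)) =
      iter m (fun v => v *m B) (map_mx (real_complex R) (passmx.rVof e x)).
    by rewrite rVof_iter; elim: m => //= m <-; rewrite map_mxM.
  have [r r01 dec] := matrix_orbit_decay eB; exists r => // x.
  have [C C0 HC] := dec (map_mx (real_complex R) (passmx.rVof e x)).
  exists C => // m j; rewrite passmx.coord_rVof -normc_real.
  by have := HC m j; rewrite -itE mxE.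
exists r => // x; have [C C0 HC] := dec x.
exists (C * \sum_(i < \dim {:V}) `|e`_i|); first by rewrite mulr_ge0// sumr_ge0.
move=> m; rewrite (sum_coord_vbasis (iter m f x)).
apply: le_trans (ler_norm_sum _ _ _) _.
rewrite mulrAC mulr_sumr; apply: ler_sum => i _.
by rewrite normrZ; apply: ler_wpM2r.
Qed.

Lemma row_linear_bounded n (W : normedModType R) (f : {linear 'rV[R]_n -> W}) :
  exists2 C, 0 <= C & forall x, `|f x| <= C * `|x|.
Proof.
exists (\sum_j `|f (delta_mx 0 j)|); first exact: sumr_ge0.
move=> x; rewrite {1}(row_sum_delta x) linear_sum.
apply: le_trans (ler_norm_sum _ _ _) _; rewrite mulr_suml; apply: ler_sum => j _.
rewrite linearZ normrZ mulrC ler_wpM2l//.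
rewrite (_ : `|x| = mx_norm x) // mx_normrE.
by apply/bigmax_geP; right; exists (0, j).
Qed.

Lemma subspace_linear_bounded (W : normedModType R) (f : {linear V -> W}) :
  exists2 C, 0 <= C & forall x, `|f x| <= C * `|x|.
Proof.
have [C C0 HC] := row_linear_bounded (f \o vsproj U).
by exists C => // x; have := HC (vsval x); rewrite /= vsvalK.
Qed.

Lemma vsproj_bounded : exists2 C, 0 <= C & forall x, `|vsproj U x| <= C * `|x|.
Proof. exact: row_linear_bounded. Qed.

Lemma vsproj_continuous : continuous (vsproj U).
Proof.
apply/linear_bounded_continuous/linear_boundedP.
have [C C0 HC] := vsproj_bounded.
near=> r => x; apply: le_trans (HC x) _; apply: ler_wpM2r => //.
Unshelve. all: by end_near. Qed.

(** Heine-Borel is carried over from row vectors: [A] is the image under the continuous [vsproj U]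
    of the bounded closed set of its values. *)
Lemma subspace_bounded_closed_compact (A : set V) :
  bounded_set A -> closed A -> compact A.
Proof.
move=> bA cA.
have -> : A = vsproj U @` (vsval @` A).
  rewrite image_comp; apply/seteqP; split=> [x Ax|_ [x Ax <-]] /=.
    by exists x; rewrite //= vsvalK.
  by rewrite vsvalK.
apply: continuous_compact; first exact/continuous_subspaceT/vsproj_continuous.
apply: bounded_closed_compact.
  case: bA => M [Mr HM]; exists M; split=> // N /HM AN _ [x Ax <-].
  exact: AN.
have [C C0 HC] := vsproj_bounded.
apply/closed_normP => x Hx.
have approx (d : R) : 0 < d -> exists2 a, A a &
    `|vsproj U x - a| < d /\ `|x - vsval a| < d.
  move=> d0; have d1 : 0 < d / (C + 1) by rewrite divr_gt0// ltr_wpDl.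
  have [_ [a Aa <-] xa] := Hx _ d1; exists a => //.
  have {}xa : `|x - vsval a| * (C + 1) < d by rewrite -ltr_pdivlMr// ltr_wpDl.
  have N0 := normr_ge0 (x - vsval a).
  split; last by nra.
  have := HC (x - vsval a); rewrite linearB /= vsvalK => /le_lt_trans; apply.
  nra.
(* A limit of points of [U] is its own projection: otherwise an approximation within half of the gap
   is contradictory. *)
exists (vsproj U x); last first.
  apply/eqP; rewrite -subr_eq0 -normr_eq0; apply/eqP/le_anti.
  rewrite normr_ge0 andbT leNgt; apply/negP => d0.
  have [|a Aa [H1 H2]] := approx (`|vsval (vsproj U x) - x| / 2); first lra.
  have : `|vsval (vsproj U x) - x| <= `|vsproj U x - a| + `|x - vsval a|.
    have -> : `|vsproj U x - a| = `|vsval (vsproj U x) - vsval a|.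
      by rewrite -linearB.
    by rewrite (distrC x); exact: ler_distD.
  lra.
move/closed_normP: cA; apply => e e0.
by have [a Aa [H1 _]] := approx e e0; exists a.
Qed.

(** The sets are pulled back along [vsproj U]. Density survives because the displacement wanted in
    [U] can be added to any row vector without changing its length. *)
Lemma subspace_Baire (F : nat -> set V) :
  (forall i, open (F i) /\ dense (F i)) -> exists x, forall i, F i x.
Proof.
move=> HF.
have projE (x : 'rV[R]_k) y : vsproj U (x + vsval (y - vsproj U x)) = y.
  by rewrite linearD [X in _ + X]vsvalK addrC subrK.
have : dense (\bigcap_i (vsproj U @^-1` F i) : set 'rV[R]_k).
  apply: Baire => i; have [oF dF] := HF i; split.
    by move/continuousP: vsproj_continuous; apply.
  apply/dense_normP => x e e0; move/dense_normP: dF => /(_ (vsproj U x) e e0).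
  move=> [y Fy xy]; exists (x + vsval (y - vsproj U x)).
    by move: Fy; rewrite -{1}(projE x y).
  by rewrite opprD addNKr normrN -(opprB (vsproj U x)) linearN normrN.
move/dense_normP => /(_ 0 1 ltr01)[x Fx _]; exists (vsproj U x) => i.
exact: Fx.
Qed.

(* The dynamical norm [sup_m |f^m x| / r^m]. *)
Lemma contractive_adapted_norm (f : 'End(V)) : contractive f ->
  exists N : V -> R, exists r C : R,
  [/\ 0 < r < 1, 0 <= C, forall x y, N (x - y) <= N x + N y,
      forall x, N (f x) <= r * N x &
      forall x, `|x| <= N x <= C * `|x|].
Proof.
move=> /contractive_orbit_decay[r /andP[r0 r1] dec].
pose S x : set R := range (fun m => `|iter m f x| / r ^+ m).
pose N x : R := sup (S x).
have S_bnd x : exists2 C, 0 <= C & ubound (S x) C.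
  have [C C0 HC] := dec x; exists C => // _ [m _ <-].
  by rewrite ler_pdivrMr ?exprn_gt0.
have S0 x : S x !=set0 by exists (`|iter 0 f x| / r ^+ 0); exists 0%N.
have S_sup x : has_sup (S x).
  by split=> //; have [C _ HC] := S_bnd x; exists C.
have NS x m : `|iter m f x| <= N x * r ^+ m.
  rewrite -ler_pdivrMr ?exprn_gt0//.
  by apply: ub_le_sup; [case: (S_sup x)|exists m].
have Nle x (c : R) : (forall m, `|iter m f x| <= c * r ^+ m) -> N x <= c.
  by move=> Hc; apply: ge_sup => // _ [m _ <-]; rewrite ler_pdivrMr ?exprn_gt0.
have iterB m x y : iter m f (x - y) = iter m f x - iter m f y.
  by elim: m => //= m ->; rewrite linearB.
have N0 x : 0 <= N x by have := NS x 0%N; rewrite expr0 mulr1; apply: le_trans.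
have NB x y : N (x - y) <= N x + N y.
  apply: Nle => m; rewrite iterB mulrDl.
  by apply: le_trans (ler_normB _ _) _; apply: lerD.
have NN0 : N 0 = 0.
  apply/le_anti; rewrite N0 andbT; apply: Nle => m.
  rewrite mul0r; suff -> : iter m f 0 = 0 by rewrite normr0.
  by elim: m => //= m ->; rewrite linear0.
have NZ a x : N (a *: x) <= `|a| * N x.
  apply: Nle => m; suff -> : iter m f (a *: x) = a *: iter m f x.
    by rewrite normrZ -mulrA ler_wpM2l.
  by elim: m => //= m ->; rewrite linearZ.
have ND x y : N (x + y) <= N x + N y.
  rewrite -{1}(opprK y); apply: le_trans (NB _ _) _; rewrite lerD2l.
  by rewrite -sub0r; apply: le_trans (NB _ _) _; rewrite NN0 add0r.
(* The bound from [dec] depends on [x]; expanding in a basis and using subadditivity makes it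
   uniform. *)
have [C C0 HC] : exists2 C, 0 <= C & forall x, N x <= C * `|x|.
  have coord_bnd i : exists2 c, 0 <= c & forall x : V, `|coord e i x| <= c * `|x|.
    exact: (@subspace_linear_bounded R^o (coord e i)).
  exists (\sum_(i < \dim {:V}) s2val (cid2 (coord_bnd i)) * N e`_i).
    by apply: sumr_ge0 => i _; rewrite mulr_ge0//; case: cid2.
  move=> x; rewrite {1}(sum_coord_vbasis x).
  have : forall s : seq 'I_(\dim {:V}),
      N (\sum_(i <- s) coord e i x *: e`_i) <= \sum_(i <- s) `|coord e i x| * N e`_i.
    elim=> [|i s IH]; first by rewrite !big_nil NN0.
    by rewrite !big_cons; apply: le_trans (ND _ _) _; apply: lerD.
  move=> /(_ (index_enum _)) /le_trans; apply.
  rewrite mulr_suml; apply: ler_sum => i _; rewrite mulrAC ler_wpM2r//.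
  by case: cid2.
exists N, r, C; split=> // [|x|x]; first by rewrite r0.
  apply: Nle => m; rewrite mulrC mulrA -exprSr -iterSr mulrC; exact: NS.
by rewrite HC andbT; have := NS x 0%N; rewrite expr0 mulr1.
Qed.


Lemma coord_bounded (i : 'I_(\dim {:V})) :
  exists2 c, 0 <= c & forall x : V, `|coord e i x| <= c * `|x|.
Proof. exact: (@subspace_linear_bounded R^o (coord e i)). Qed.

(** A complex eigenvector is a complex combination of the real basis vectors, so its orbit
    [z ^+ m *: v] tends to 0 with theirs. *)
Lemma decay_contractive (f : 'End(V)) :
  (forall x (d : R), 0 < d -> exists m0, forall m, (m0 <= m)%N -> `|iter m f x| <= d) ->
  contractive f.
Proof.
move=> dec z /eigenvalueP[v vB v0].
set B := map_mx _ _ in vB.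
have [j vj] : exists j, v 0 j != 0.
  apply/existsP; apply: contraNT v0; rewrite negb_exists => /forallP v0.
  by apply/eqP/rowP => j; rewrite mxE; apply/eqP; rewrite -[_ == _]negbK.
rewrite norm_normc -[1]/((1 : R)%:C)%C ltcR ltNge; apply/negP => z1.
have [c c0 Hc] := coord_bounded j.
have vj0 : 0 < normc (v 0 j).
  rewrite lt_neqAle normc_ge0 andbT eq_sym.
  by apply: contra vj => /eqP/Normc.eq0_normc ->.
pose T := \sum_i normc (v 0 i) * c.
have T0 : 0 <= T by apply: sumr_ge0 => i _; rewrite mulr_ge0 ?normc_ge0.
(* Chosen so that the sum over the basis, at most [T] times this, stays below [normc (v 0 j)]. *)
have d0 : 0 < normc (v 0 j) / 2 / (T + 1) by rewrite !divr_gt0// ltr_wpDl.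
have [m Hm] : exists m, forall i : 'I_(\dim {:V}),
    `|iter m f e`_i| <= normc (v 0 j) / 2 / (T + 1).
  have /choice[m0 Hm0] : forall i : 'I_(\dim {:V}), exists m0, forall m,
      (m0 <= m)%N -> `|iter m f e`_i| <= normc (v 0 j) / 2 / (T + 1).
    by move=> i; exact: dec.
  exists (\max_i m0 i) => i; apply: (Hm0 i); exact: (@leq_bigmax _ m0 i).
have iterE : iter m (fun w => w *m B) v = z ^+ m *: v.
  elim: m {Hm} => [|m IH]; first by rewrite expr0 scale1r.
  by rewrite iterS IH -scalemxAl vB scalerA exprSr.
have iterL : iter m (fun w => w *m B) v =
    \sum_i v 0 i *: map_mx (real_complex R) (passmx.rVof e (iter m f e`_i)).
  elim: m {Hm iterE} => [|m IH].
    rewrite {1}(row_sum_delta v); apply: eq_bigr => i _ /=; congr (_ *: _).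
    by rewrite (@passmx.rVofE _ _ e (vbasisP _)) map_delta_mx.
  rewrite iterS IH mulmx_suml; apply: eq_bigr => i _.
  by rewrite -scalemxAl -map_mxM -(@passmx.rVof_app _ _ _ e e (vbasisP _)).
have : normc (z ^+ m * v 0 j) <= T * (normc (v 0 j) / 2 / (T + 1)).
  have -> : z ^+ m * v 0 j = (z ^+ m *: v) 0 j by rewrite mxE.
  rewrite -iterE iterL summxE.
  have : forall s : seq 'I_(\dim {:V}), normc (\sum_(i <- s)
      (v 0 i *: map_mx (real_complex R) (passmx.rVof e (iter m f e`_i))) 0 j) <=
      \sum_(i <- s) normc (v 0 i) * c * (normc (v 0 j) / 2 / (T + 1)).
    elim=> [|i s IH]; first by rewrite !big_nil Normc.normc0.
    rewrite !big_cons; apply: le_trans (le_normcD _ _) _; apply: lerD => //.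
    rewrite !mxE Normc.normcM -mulrA ler_wpM2l ?normc_ge0//.
    by rewrite normc_real; apply: le_trans (Hc _) _; rewrite ler_wpM2l.
  by move=> /(_ (index_enum _)) /le_trans; apply; rewrite mulr_suml.
have zm : 1 <= normc (z ^+ m).
  elim: m {Hm iterE iterL} => [|m IH]; first by rewrite expr0 Normc.normc1.
  by rewrite exprS Normc.normcM -[leLHS]mulr1 ler_pM.
rewrite Normc.normcM => H.
have : normc (v 0 j) <= normc (v 0 j) / 2 * (T / (T + 1)).
  apply: le_trans (le_trans _ H) _; first by rewrite ler_peMl ?(ltW vj0).
  by rewrite [leLHS](_ : _ = normc (v 0 j) / 2 * (T / (T + 1))) //; ring.
have T1 : T / (T + 1) <= 1 by rewrite ler_pdivrMr ?mul1r ?lerDl// ltr_wpDl.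
have T2 : 0 <= T / (T + 1) by rewrite divr_ge0// addr_ge0.
nra.
Qed.

Lemma expansive_lker0 (f : 'End(V)) : expansive f -> lker f == 0%VS.
Proof.
move=> ef; apply/lker0P; apply: raddf_inj => x fx0; apply/eqP/negPn/negP => x0.
suff /ef : complex_eigenvalue f 0 by rewrite normr0 ltr10.
apply/eigenvalueP; exists (map_mx (real_complex R) (passmx.rVof e x)).
  by rewrite -map_mxM -(@passmx.rVof_app _ _ _ e e (vbasisP _)) fx0 (_ : passmx.rVof e 0 = 0) ?map_mx0 ?scale0r//; apply/eqP; rewrite (passmx.rVof_eq0 (vbasisP _)).
by rewrite map_mx_eq0 (passmx.rVof_eq0 (vbasisP _)).
Qed.

Lemma expansive_inv_contractive (f : 'End(V)) : expansive f -> contractive (f^-1)%VF.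
Proof.
move=> ef z /eigenvalueP[v vB v0]; have kf := expansive_lker0 ef.
pose A := map_mx (real_complex R) (passmx.mxof e e f).
set B := map_mx _ _ in vB.
have BA : B *m A = 1%:M.
  rewrite -map_mxM -(@passmx.mxof_comp _ _ _ _ _ _ _ (vbasisP _)).
  by rewrite lker0_compfV// (@passmx.mxof1 _ _ _ (basis_free (vbasisP _))) map_mx1.
have vE : v = z *: (v *m A) by rewrite scalemxAl -vB -mulmxA BA mulmx1.
have z0 : z != 0 by apply: contra v0 => /eqP z0; rewrite vE z0 scale0r.
have /ef : complex_eigenvalue f z^-1.
  apply/eigenvalueP; exists v => //; apply: (scalerI z0).
  by rewrite -vE scalerA mulfV// scale1r.
by rewrite normfV invf_gt1 ?normr_gt0.
Qed.

End OnSubspace.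
End SpectralBounds.

(** * Separation by translates of a window *)

Lemma seq_common_radius (R : realType) (T : eqType) (s : seq T) (Q : T -> R -> Prop) :
  (forall x d e, d <= e -> Q x e -> Q x d) ->
  (forall x, x \in s -> exists2 e, 0 < e & Q x e) ->
  exists2 e, 0 < e & forall x, x \in s -> Q x e.
Proof.
move=> Qmono; elim: s => [|a s IH] H; first by exists 1.
have [e e0 He] := H a (mem_head _ _).
have [x xs|d d0 Hd] := IH; first by apply: H; rewrite inE xs orbT.
exists (Num.min d e); first by rewrite lt_min d0.
move=> x; rewrite inE => /orP[/eqP ->|/Hd Qd];
  by [apply: Qmono He; rewrite ge_min lexx orbT
     |apply: Qmono Qd; rewrite ge_min lexx].
Qed.

Lemma seq_common_bound (R : realType) (T : eqType) (s : seq T) (f : T -> R) :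
  exists2 M, 0 <= M & forall x, x \in s -> f x <= M.
Proof.
exists (\sum_(x <- s) `|f x|); first exact: sumr_ge0.
move=> x xs; apply: le_trans (ler_norm _) _.
by rewrite (big_rem x)//= lerDl sumr_ge0.
Qed.

Section CutProject.
Variables (R : realType) (E : zmodType) (V H : normedModType R).
Variables (G : zmodClosed E) (pv : {additive E -> V}) (ph : {additive E -> H}).

(* The only properties of a cut and project scheme used below; [E], [V] and [H]
   are the total, physical and internal spaces. *)
Record lattice_scheme : Prop := {
  scheme_finite : forall r : R, exists s : seq E,
    forall g, g \in G -> `|pv g| <= r -> `|ph g| <= r -> g \in s;
  scheme_dense : forall h (e : R), 0 < e -> exists2 g, g \in G & `|h - ph g| < e;
  scheme_inj : forall g, g \in G -> pv g = 0 -> g = 0;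
  scheme_cocompact : exists C : R, forall v h,
    exists2 g, g \in G & `|pv g - v| <= C /\ `|ph g - h| <= C;
  scheme_compact : forall A : set H, bounded_set A -> closed A -> compact A
}.

Hypothesis LS : lattice_scheme.

Lemma pv_inj g h : g \in G -> h \in G -> pv g = pv h -> g = h.
Proof.
move=> gG hG gh; apply/eqP; rewrite -subr_eq0; apply/eqP.
by apply: (scheme_inj LS); rewrite ?rpredB// raddfB gh subrr.
Qed.

(** Compactness of the ball makes finitely many lattice translations enough to reach the target [u].
    Finiteness bounds their physical length, and so the radius of the patches in which they are
    seen. *)
Lemma lattice_net (rho eta : R) (u : H) : 0 < eta ->
  exists F : seq E, (forall f, f \in F -> f \in G) /\
    forall x, `|x| <= rho -> exists2 f, f \in F & `|x + ph f - u| < eta.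
Proof.
move=> eta0.
have cB : compact [set x : H | `|x| <= rho].
  apply: (scheme_compact LS); first by apply/bounded_set_normP; exists rho.
  apply/closed_normP => x Hx /=; rewrite leNgt; apply/negP => xr.
  have [|y /= yr] := Hx (`|x| - rho); first by rewrite subr_gt0.
  have := ler_normD (x - y) y; rewrite subrK; lra.
have [||F [FG FB]] := @compact_finite_cover R H _ E [set g | g \in G]
  (fun g => [set x | `|x + ph g - u| < eta]) cB.
- move=> g _; apply/open_normP => x /= xg.
  exists (eta - `|x + ph g - u|); first by rewrite subr_gt0.
  move=> y xy; have := ler_normD (x + ph g - u) (y - x).
  have -> : x + ph g - u + (y - x) = y + ph g - u by rewrite addrC -!addrA addKr.
  by rewrite (distrC y); lra.
- move=> x _; have [g gG Hg] := scheme_dense LS (u - x) eta0.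
  by exists g => //=; rewrite -normrN opprB opprD addrA.
by exists F.
Qed.

(** Cocompactness gives a lattice point within [C] in both components; an element of the net then
    corrects the internal part at bounded physical cost. *)
Lemma lattice_relatively_dense (h : H) (e : R) : 0 < e ->
  exists rho : R, forall v, exists2 g, g \in G & `|pv g - v| <= rho /\ `|ph g - h| < e.
Proof.
move=> e0; have [C HC] := scheme_cocompact LS.
have [F [FG HF]] := lattice_net C 0 e0.
have [M M0 HM] := seq_common_bound F (fun f => `|pv f|).
exists (C + M) => v; have [g gG [gv gh]] := HC v h.
have [f fF Hf] := HF _ gh.
exists (g + f); first by rewrite rpredD// FG.
rewrite !raddfD; split; last by rewrite addrAC -[X in `|X|]subr0.
rewrite addrAC; apply: le_trans (ler_normD _ _) _; apply: lerD => //.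
exact: HM.
Qed.

Definition regular_window (K : set H) :=
  [/\ compact K, K = closure (interior K) & K !=set0].

Lemma regular_interior K x (e : R) : regular_window K -> K x -> 0 < e ->
  exists2 y, interior K y & `|x - y| < e.
Proof. by move=> [_ KE _]; rewrite {1}KE => /closure_normP; apply. Qed.

(* If [K + v] stayed in [K] then so would all [K + n v], but [K] is bounded. *)
Lemma window_escape K v : regular_window K -> v != 0 ->
  exists u, exists2 e : R, 0 < e & (forall w, `|u - w| < e -> K w) /\
                               (forall w, `|u + v - w| < e -> ~ K w).
Proof.
move=> rK v0; have [cK KE [x0 Kx0]] := rK.
have clK : closed K by apply: compact_closed => //; exact: norm_hausdorff.
have [u [Ku Kuv]] : exists u, interior K u /\ ~ K (u + v).
  apply: contrapT => noesc.
  have stay w : K w -> K (w + v).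
    move=> Kw; move/closed_normP: clK; apply => e e0.
    have [y Ky wy] := regular_interior rK Kw e0.
    exists (y + v); last by rewrite opprD addrACA subrr addr0.
    by apply: contrapT => Kyv; apply: noesc; exists y.
  have stayn n : K (x0 + v *+ n).
    by elim: n => [|n IH]; rewrite ?addr0// mulrSr addrA; exact: stay.
  have [M HM] := compact_norm_bounded cK.
  have vp : 0 < `|v| by rewrite normr_gt0.
  have [n Hn] : exists n, M + `|x0| < `|v| *+ n.
    exists (Num.trunc ((M + `|x0|) / `|v|)).+1.
    by rewrite -mulr_natl -ltr_pdivrMr// truncnS_gt.
  have := HM _ (stayn n); have := ler_normB (x0 + v *+ n) x0.
  by rewrite addrC addKr normrMn; lra.
move/interior_normP: Ku => [e e0 He].
have [d d0 Hd] : exists2 d : R, 0 < d & forall w, `|u + v - w| < d -> ~ K w.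
  apply: contrapT => nod; apply: Kuv; move/closed_normP: clK; apply => d d0.
  apply: contrapT => noy; apply: nod; exists d => // w wd Kw.
  by apply: noy; exists w.
exists u, (Num.min e d); first by rewrite lt_min e0.
by split=> w; rewrite lt_min => /andP[? ?]; [exact: He|exact: Hd].
Qed.

(** This is why a bounded patch determines an internal coordinate up to [delta]: the answers to
    whether the translates by [F] lie in [K] distinguish [x] from [y]. *)
Lemma window_separation K (rho delta : R) : regular_window K -> 0 < delta ->
  exists F : seq E, (forall f, f \in F -> f \in G) /\
    forall x y, `|x| <= rho -> delta <= `|x - y| ->
      exists2 f, f \in F & K (x + ph f) /\ ~ K (y + ph f).
Proof.
move=> rK delta0; have [cK KE [k0 Kk0]] := rK.
have [M HM] := compact_norm_bounded cK.
have M0 : 0 <= M by apply: le_trans (HM _ Kk0).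
(* Displacements longer than the diameter of [K] are separated by any point. *)
pose D := [set v : H | delta <= `|v| /\ `|v| <= M + M + 1].
have cD : compact D.
  apply: (scheme_compact LS).
    by apply/bounded_set_normP; exists (M + M + 1) => x [].
  apply/closed_normP => x Hx; split; rewrite leNgt; apply/negP => xr.
    have [|y [/= yr _]] := Hx (delta - `|x|); first by rewrite subr_gt0.
    have := ler_normD (y - x) x; rewrite subrK (distrC y); lra.
  have [|y [/= _ yr]] := Hx (`|x| - (M + M + 1)); first by rewrite subr_gt0.
  have := ler_normD (x - y) y; rewrite subrK; lra.
(* A pair [(u, e)] treats a displacement [v] when the [e]-ball at [u] lies in [K] and a slightly
   larger ball at [u + v] misses [K]. The slack [d] makes the set of such [v] open. *)
pose esc (ue : H * R) := 0 < ue.2 /\ forall w, `|ue.1 - w| < ue.2 -> K w.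
pose cov (ue : H * R) := [set v : H |
  exists2 d : R, 0 < d & forall w, `|ue.1 + v - w| < ue.2 + d -> ~ K w].
have [||s [sesc scov]] := @compact_finite_cover R H D (H * R)%type esc cov cD.
- move=> [u e] [/= e0 _]; apply/open_normP => v [d d0 Hd].
  exists (d / 2); first lra.
  move=> w vw; exists (d / 2); first lra.
  move=> z /= Hz; apply: Hd => /=.
  have := ler_normD (u + w - z) (v - w).
  have -> : u + w - z + (v - w) = u + v - z by rewrite addrC (addrC u w) !addrA subrK (addrC v).
  lra.
- move=> v [dv _]; have v0 : v != 0 by rewrite -normr_gt0; lra.
  have [u [e e0 [H1 H2]]] := window_escape rK v0.
  exists (u, e / 2).
    by split=> /= [|w Hw]; [lra|apply: H1; lra].
  by exists (e / 2) => /= [|w Hw]; [lra|apply: H2; lra].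
have [u Ku _] := regular_interior rK Kk0 ltr01.
move/interior_normP: Ku => [e e0 He].
have /choice[net Hnet] : forall ue : H * R, exists F : seq E,
    (forall f, f \in F -> f \in G) /\ (0 < ue.2 ->
    forall x, `|x| <= rho -> exists2 f, f \in F & `|x + ph f - ue.1| < ue.2).
  move=> [u' e'] /=; have [e'0|e'0] := ltP 0 e'.
    by have [F [FG HF]] := lattice_net rho u' e'0; exists F.
  by exists [::].
exists (flatten [seq net ue | ue <- (u, e) :: s]); split.
  by move=> f /flattenP[_ /mapP[ue _ ->]] /(proj1 (Hnet ue)).
move=> x y xrho dxy.
have [yx|yx] := leP `|y - x| (M + M + 1).
  have [|[u' e'] ues [d d0 Hd]] := scov (y - x); first by split; rewrite // distrC.
  have [e'0 He'] := sesc _ ues.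
  have [f fF Hf] := (proj2 (Hnet (u', e'))) e'0 x xrho.
  exists f; last split.
  - by apply/flattenP; exists (net (u', e')) => //; apply: map_f; rewrite inE ues orbT.
  - by apply: He'; rewrite distrC.
  apply: Hd => /=; rewrite distrC.
  have -> : y + ph f - (u' + (y - x)) = x + ph f - u'.
    by rewrite opprD opprB (addrC (- u')) addrA [y + _ + _]addrC addrA subrK.
  by move: Hf => /=; lra.
have [f fF Hf] := (proj2 (Hnet (u, e))) e0 x xrho.
have Kf : K (x + ph f) by apply: He; rewrite distrC.
exists f; last split=> //.
  by apply/flattenP; exists (net (u, e)); rewrite //= mem_head.
move=> Kyf; have := ler_normB (y + ph f) (x + ph f).
rewrite opprD addrACA subrr addr0.
by have := HM _ Kyf; have := HM _ Kf; lra.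
Qed.

End CutProject.

(** * Return vectors and model sets *)

Section ReturnVectors.
Variables (R : realType) (V : normedModType R).
Implicit Types S : set V.

(** The region [S] is arbitrary, so that balls of an adapted norm can serve as well as those of the
    given one. *)
Definition same_patch l (P : multiset V l) S x y :=
  forall i t, S t -> (P i (x + t) <-> P i (y + t)).

Definition return_vector l (P : multiset V l) S v :=
  exists x, same_patch P S x (x + v).

Lemma translateE (A : set V) t x : translate A t x <-> A (x - t).
Proof.
split=> [[a Aa <-]|Ax]; first by rewrite addrK.
by exists (x - t); rewrite ?subrK.
Qed.

Lemma closure_translate (A : set V) s x : closure (translate A s) x <-> closure A (x - s).
Proof.
have E (y : V) : x - s - (y - s) = x - y by rewrite opprB addrA subrK.
rewrite !closure_normP; split=> cA e /cA[y].
  by move=> /translateE Ay xy; exists (y - s); rewrite ?E.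
by move=> Ay xy; exists (y + s); rewrite ?translateE ?addrK// -E addrK.
Qed.

Lemma interior_translate (A : set V) s x : interior (translate A s) x <-> interior A (x - s).
Proof.
have E (y : V) : x - s - (y - s) = x - y by rewrite opprB addrA subrK.
split=> /interior_normP[e e0 He]; apply/interior_normP; exists e => // y xy.
  by rewrite -(addrK s y); apply/translateE/He; rewrite -E addrK.
by apply/translateE/He; rewrite E.
Qed.

Lemma local_patch_same l (P : multiset V l) x y (r : R) :
  local_patch P x r = local_patch P y r <->
  same_patch P [set t | `|t| <= r] x y.
Proof.
have lpE z i t : local_patch P z r i t <-> P i (z + t) /\ `|t| <= r.
  rewrite /local_patch translateE opprK addrC; split=> [[]|[]] Pt.
    by rewrite /closed_ball_ /= opprD addrA subrr sub0r normrN.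
  by move=> tr; split=> //; rewrite /closed_ball_ /= opprD addrA subrr sub0r normrN.
split=> [lp i t /= tr|sp].
  have := lpE x i t; have := lpE y i t; rewrite lp => Hy Hx.
  by split=> Pt; [case: (Hy.1 (Hx.2 (conj Pt tr)))|case: (Hx.1 (Hy.2 (conj Pt tr)))].
apply/funext => i; apply/seteqP; split=> t /lpE[Pt tr]; apply/lpE; split=> //.
  exact/(sp i t tr).
exact/(sp i t tr).
Qed.

(** One implication suffices because agreement of patches is symmetric in [x] and [y]. *)
Lemma locally_derivableP l m (Q : multiset V m) (P : multiset V l) :
  locally_derivable Q P <-> exists2 c : R, 0 <= c &
    forall x y, same_patch P [set t | `|t| <= c] x y -> forall i, Q i x -> Q i y.
Proof.
split=> [[c c0 Hc]|[c c0 Hc]]; exists c => // x y.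
  move=> /local_patch_same/Hc/local_patch_same/(_ _ 0) Q0 i.
  by move: (Q0 i); rewrite /= !addr0 normr0 lexx => /(_ isT)[].
move=> /local_patch_same sp; apply/local_patch_same => i t /=.
rewrite normr_le0 => /eqP ->; rewrite !addr0; split; apply: Hc => //.
by move=> j t' /sp; move=> /(_ j) [].
Qed.

Lemma locally_derivable_trans l m n (P : multiset V l) (Q : multiset V m)
    (T : multiset V n) :
  locally_derivable T Q -> locally_derivable Q P -> locally_derivable T P.
Proof.
move=> /locally_derivableP[c c0 Hc] /locally_derivableP[d d0 Hd].
apply/locally_derivableP; exists (c + d); first exact: addr_ge0.
move=> x y sp; apply: Hc => i t /= tc; split; apply: Hd => j u /= ud.
  rewrite -!addrA; apply: sp => /=; apply: le_trans (ler_normD _ _) _; exact: lerD.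
have [] := sp j (t + u); first by apply: le_trans (ler_normD _ _) _; exact: lerD.
by rewrite -!addrA.
Qed.

Lemma LI_transfer l (P Q : multiset V l) (r : R) : LI P Q ->
  exists t, forall i u, `|u| <= r -> (P i u <-> Q i (u + t)).
Proof.
move=> /(_ [set u | `|u| <= r])[|t Ht]; first by apply/bounded_set_normP; exists r.
exists t => i u ur; have := Ht i => /seteqP[H1 H2]; split=> [Pu|Qu].
  by have [|] // := H1 (u + t); apply/translateE; rewrite addrK.
have : translate (P i `&` [set u | `|u| <= r]) t (u + t).
  by apply: H2; split=> //; apply/translateE; rewrite /= addrK.
by move/translateE; rewrite addrK => -[].
Qed.

(** A ball about the origin containing both [x + S] and [x + v + S] is matched as a whole, so the
    coincidence moves to [Q] with the same [v]. *)
Lemma LI_return_vector l (P Q : multiset V l) S (r : R) v :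
  LI P Q -> (forall t, S t -> `|t| <= r) -> return_vector P S v ->
  return_vector Q S v.
Proof.
move=> PQ Sr [x sx]; have [t Ht] := LI_transfer (`|x| + `|v| + r) PQ.
exists (x + t) => i s Ss; have sr := Sr s Ss.
have E y : y + s + t = y + t + s by rewrite addrAC.
rewrite (addrAC x t v) -!E; split=> Qs; apply/Ht.
- by have := ler_normD (x + v) s; have := ler_normD x v; lra.
- apply/(sx i s Ss)/Ht => //.
  by have := ler_normD x s; have := normr_ge0 v; lra.
- by have := ler_normD x s; have := normr_ge0 v; lra.
- apply/(sx i s Ss)/Ht => //.
  by have := ler_normD (x + v) s; have := ler_normD x v; lra.
Qed.

End ReturnVectors.

(** * Patches and return vectors of model sets *)

Section ModelSets.
Variables (R : realType) (E : zmodType) (V H : normedModType R).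
Variables (G : zmodClosed E) (pv : {additive E -> V}) (ph : {additive E -> H}).
Hypothesis LS : lattice_scheme G pv ph.

(** The window is [W] shifted by [s]; keeping [s] as a parameter allows the shifts of one window to
    be compared. *)
Definition model_set l (W : 'I_l -> set H) (s : H) : multiset V l :=
  fun i => [set pv g | g in [set g | g \in G /\ W i (ph g - s)]].

Definition generic_shift l (W : 'I_l -> set H) (s : H) :=
  forall i g, g \in G -> interior (W i) (ph g - s) \/ ~ closure (W i) (ph g - s).

Lemma model_setE l (W : 'I_l -> set H) s i g : g \in G ->
  model_set W s i (pv g) <-> W i (ph g - s).
Proof.
move=> gG; split=> [[h [hG Wh] /(pv_inj LS hG gG) <-//]|Wg].
by exists g.
Qed.

Section Window.
Variables (l : nat) (W : 'I_l -> set H) (rho : R).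
Hypothesis W_bounded : forall i h, W i h -> `|h| <= rho.

(** Only finitely many lattice points of bounded physical part come near the window, each at a
    positive distance from its boundary; the others stay outside under small [u]. *)
Lemma generic_stable s (r : R) : generic_shift W s ->
  exists2 e : R, 0 < e & forall i g u, g \in G -> `|pv g| <= r -> `|u| < e ->
    (W i (ph g - s + u) <-> W i (ph g - s)).
Proof.
move=> gs.
(* The summand 1 absorbs [u], whose size is capped at 1 below. *)
have [F HF] := scheme_finite LS (`|r| + `|rho| + `|s| + 1).
pose Q (ig : 'I_l * E) e := forall u : H, ig.2 \in G -> `|u| < e ->
    (W ig.1 (ph ig.2 - s + u) <-> W ig.1 (ph ig.2 - s)).
have [||e e0 He] := @seq_common_radius R _ [seq (i, g) | i <- enum 'I_l, g <- F] Q.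
- by move=> ig d e de He u gG ud; apply: He => //; exact: lt_le_trans de.
- move=> [i g] _; rewrite /Q /=; have [gG|gG] := boolP (g \in G); last by exists 1.
  have [/interior_normP[e e0 He]|ncl] := gs i g gG.
    have W0 : W i (ph g - s) by apply: He; rewrite subrr normr0.
    exists e => // u _ ue; split=> // _; apply: He.
    by rewrite opprD addNKr normrN.
  have [e e0 He] : exists2 e : R, 0 < e &
      forall w, `|ph g - s - w| < e -> ~ W i w.
    apply: contrapT => noe; apply: ncl; apply/closure_normP => e e0.
    apply: contrapT => noy; apply: noe; exists e => // w we Ww.
    by apply: noy; exists w.
  exists e => // u _ ue; split=> Wg; exfalso; apply: He Wg.
    by rewrite opprD addNKr normrN.
  by rewrite subrr normr0.
exists (Num.min e 1); first by rewrite lt_min e0 ltr01.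
move=> i g u gG gr; rewrite lt_min => /andP[ue u1].
have [gF|gF] := boolP (g \in F).
  apply: (He (i, g)) => //.
  by apply/allpairsP; exists (i, g); split=> //=; rewrite mem_enum.
have big : `|rho| + `|s| + 1 < `|ph g|.
  rewrite ltNge; apply: contra gF => gh; apply: HF => //.
    by have := ler_norm r; have := normr_ge0 rho; have := normr_ge0 s; lra.
  by have := normr_ge0 r; lra.
have rr := ler_norm rho.
split=> /W_bounded Hw.
  have := ler_normD (ph g - s + u) s; have := ler_normB (ph g - s + u + s) u.
  by rewrite (addrAC _ u s) subrK addrK; lra.
have := ler_normD (ph g - s) s; rewrite subrK; lra.
Qed.

(** Translation by [pv g2] changes the shift by [ph g2]; when this nearly equals [s' - s], the
    remaining error is harmless by [generic_stable]. *)
Lemma model_set_shift s s' (r : R) : generic_shift W s ->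
  exists2 e : R, 0 < e & forall g2 i v, g2 \in G -> `|s' - s - ph g2| < e ->
    `|v| <= r -> (model_set W s i v <-> model_set W s' i (v + pv g2)).
Proof.
move=> gs; have [e e0 He] := generic_stable r gs.
exists e => // g2 i v g2G g2e vr.
have key g : g \in G -> v = pv g ->
    (model_set W s i (pv g) <-> model_set W s' i (pv g + pv g2)).
  move=> gG vE; rewrite -raddfD !model_setE ?rpredD// raddfD.
  have -> : ph g + ph g2 - s' = ph g - s + (ph g2 - (s' - s)).
    by rewrite opprB addrACA addKr.
  apply: iff_sym; apply: He => //; first by rewrite -vE.
  by rewrite distrC.
split=> [Pv|].
  by have [g [gG _] gv] := Pv; rewrite -gv in Pv *; apply/key.
move=> Pv; have [g [gG _] gv] := Pv.
have vE : v = pv (g - g2) by rewrite raddfB gv addrK.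
have := key (g - g2) (rpredB gG g2G) vE; rewrite -vE => -[_]; exact.
Qed.

Lemma model_set_LI s s' : generic_shift W s ->
  LI (model_set W s) (model_set W s').
Proof.
move=> gs U /bounded_set_normP[r Ur].
have [e e0 He] := model_set_shift s' r gs.
have [g gG Hg] := scheme_dense LS (s' - s) e0.
exists (pv g) => i; apply/seteqP; split=> x.
  move=> /translateE[Px Ux]; split; last exact/translateE.
  by rewrite -(subrK (pv g) x); apply/He => //; exact: Ur.
move=> [Qx /translateE Ux]; apply/translateE; split=> //.
by apply/(He g) => //; [exact: Ur|rewrite subrK].
Qed.

(** Two lattice points [h] and [h + g] with small internal parts see the same points within distance
    [r]. The point [h] is taken in the region where [P] has been matched with the model set; each of
    [h] and [g] gets half of the tolerance. *)
Lemma small_return_vector (P : multiset V l) s (S : set V) (r : R) :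
  generic_shift W s -> LI P (model_set W s) -> (forall t, S t -> `|t| <= r) ->
  exists2 e : R, 0 < e & forall g, g \in G -> `|ph g| < e ->
    return_vector P S (pv g).
Proof.
move=> gs PL Sr; have [e e0 He] := generic_stable r gs.
have e2 : 0 < e / 2 by lra.
have [rad Hrad] := lattice_relatively_dense LS 0 e2.
exists (e / 2) => // g gG ge.
have [t Ht] := LI_transfer (rad + `|pv g| + r) PL.
have [h hG [hv]] := Hrad t; rewrite subr0 => hh.
have key y x : `|x| <= rad + `|pv g| + r -> x + t = y -> forall i,
    P i x <-> model_set W s i y.
  by move=> xr <- i; exact: Ht.
exists (pv h - t) => i u Su; have ur := Sr u Su.
have pg := normr_ge0 (pv g).
have := ler_normD (pv h - t) u; have := ler_normD (pv h - t + pv g) u.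
have := ler_normD (pv h - t) (pv g) => n1 n2 n3.
rewrite (key (pv h + u)); [|lra|by rewrite addrAC subrK].
rewrite (key (pv (h + g) + u)); [|lra|].
  have [[w wG wu]|now] := pselect (exists2 w, w \in G & pv w = u).
    rewrite -wu -!raddfD !model_setE ?rpredD// !raddfD.
    have -> : ph h + ph w - s = ph w - s + ph h by rewrite (addrC (ph h)) addrAC.
    have -> : ph h + ph g + ph w - s = ph w - s + (ph h + ph g).
      by rewrite (addrC (ph h + ph g)) addrAC.
    have wr : `|pv w| <= r by rewrite wu.
    have := ler_normD (ph h) (ph g) => n4.
    by rewrite !He//; lra.
  have none z : z \in G -> ~ model_set W s i (pv z + u).
    move=> zG [w [wG _] wE]; apply: now; exists (w - z); first by rewrite rpredB.
    by rewrite raddfB wE addrC addKr.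
  by split=> /none [] //; rewrite rpredD.
by rewrite raddfD (addrAC _ u t) (addrAC _ _ t) subrK.
Qed.

(** The radius meets two needs: within [rho0] every centre sees a point [a] of colour [i0], and a
    further [M] covers the separating translates [F]. The vector [v] carries [a] to a point [b], and
    equal patches there force close internal parts. *)
Lemma return_vector_small i0 s (eta : R) : regular_window (W i0) -> 0 < eta ->
  exists c : R, forall P : multiset V l, LI P (model_set W s) ->
    forall v, return_vector P [set t | `|t| <= c] v ->
    exists2 g, g \in G & pv g = v /\ `|ph g| < eta.
Proof.
move=> rW eta0.
have [x1 Wx1] : interior (W i0) !=set0.
  case: (rW) => _ _ [x Wx].
  by have [y Wy _] := regular_interior rW Wx ltr01; exists y.
move/interior_normP: Wx1 => [e e0 He].
have [rho0 Hrho0] := lattice_relatively_dense LS (x1 + s) e0.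
have [F [FG HF]] := window_separation LS rho rW eta0.
have [M M0 HM] := seq_common_bound F (fun f => `|pv f|).
exists (rho0 + M) => P PL v rv.
have [x sx] := LI_return_vector PL (fun t tr => tr) rv.
have [a aG [av ah]] := Hrho0 x.
have Wa : W i0 (ph a - s).
  by apply: He; rewrite distrC -addrA -opprD (addrC s).
have [t0 pvaE t0r] : exists2 t0, pv a = x + t0 & `|t0| <= rho0.
  by exists (pv a - x); rewrite // addrC subrK.
have same f : `|pv f| <= M ->
    (model_set W s i0 (pv a + pv f) <-> model_set W s i0 (pv a + v + pv f)).
  move=> fM; have := sx i0 (t0 + pv f).
  rewrite pvaE (addrAC x t0 v) -!addrA; apply => /=.
  by apply: le_trans (ler_normD _ _) _; apply: lerD.
have [b [bG Wb] bv] : model_set W s i0 (pv a + v).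
  have := same 0; rewrite raddf0 normr0 !addr0 => /(_ M0) [H1 _].
  by apply: H1; apply/model_setE.
have vE : pv (b - a) = v by rewrite raddfB bv addrC addKr.
exists (b - a); first by rewrite rpredB.
split=> //; rewrite ltNge; apply/negP => big.
have [||f fF [H1 H2]] := HF (ph a - s) (ph b - s).
- exact: W_bounded Wa.
- by rewrite opprB addrA subrK distrC -raddfB.
have fG := FG _ fF; apply: H2.
have : model_set W s i0 (pv a + v + pv f).
  apply/same; first exact: HM.
  by rewrite -raddfD; apply/model_setE; rewrite ?rpredD// raddfD addrAC.
by rewrite -bv -raddfD model_setE ?rpredD// raddfD addrAC.
Qed.

(** Close points of the set differ by a lattice vector bounded in both components, so by one of
    finitely many. *)
Lemma model_set_delone i0 s : interior (W i0) !=set0 -> delone (model_set W s).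
Proof.
move=> [x1 /interior_normP[e e0 He]]; split; last first.
  have [rho0 Hrho0] := lattice_relatively_dense LS (x1 + s) e0.
  exists rho0 => x; have [a aG [av ah]] := Hrho0 x.
  exists (pv a); last by rewrite distrC.
  exists i0 => //; apply/model_setE => //.
  by apply: He; rewrite distrC -addrA -opprD (addrC s).
have [F HF] := scheme_finite LS (`|rho| + `|rho| + 1).
have [||d d0 Hd] := @seq_common_radius R _ F
  (fun g d => g \in G -> g != 0 -> d <= `|pv g|).
- by move=> g d' e' de Hg gG g0; exact: le_trans de (Hg gG g0).
- move=> g _; have [->|g0] := eqVneq g 0; first by exists 1; rewrite ?eqxx.
  have [gG|gG] := boolP (g \in G); last by exists 1.
  exists `|pv g| => //; rewrite normr_gt0; apply: contra g0 => /eqP g0.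
  by rewrite (scheme_inj LS gG g0).
exists (Num.min d 1); first by rewrite lt_min d0 ltr01.
move=> _ _ [i _ [g [gG Wg] <-]] [j _ [h [hG Wh] <-]] gh.
rewrite leNgt; apply/negP; rewrite lt_min => /andP[ltd lt1].
have ghG : g - h \in G by rewrite rpredB.
have : d <= `|pv (g - h)|.
  apply: Hd => //; last by apply: contra gh; rewrite subr_eq0 => /eqP ->.
  have rr := ler_norm rho; have r0 := normr_ge0 rho.
  apply: HF => //; first by rewrite raddfB; lra.
  have := ler_normB (ph g - s) (ph h - s); rewrite opprB addrA subrK -raddfB.
  by have := W_bounded Wg; have := W_bounded Wh; lra.
by rewrite raddfB; lra.
Qed.

End Window.
End ModelSets.

(** * Substitutional patterns *)

Lemma expr_inv_unbounded (R : realType) (r M : R) : 0 < r < 1 ->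
  exists m0, forall m, (m0 <= m)%N -> M <= (r ^+ m)^-1.
Proof.
move=> /andP[r0 r1].
have q1 : 1 < r^-1 by rewrite invf_gt1.
have bern m : 1 + (r^-1 - 1) *+ m <= (r ^+ m)^-1.
  elim: m => [|m IH]; first by rewrite expr0 invr1 mulr0n addr0.
  rewrite exprSr invfM mulrSr.
  have : 0 <= (r^-1 - 1) *+ m by rewrite mulrn_wge0// subr_ge0 ltW.
  by nra.
exists (Num.trunc (M / (r^-1 - 1))).+1 => m Hm.
have h0 : 0 < r^-1 - 1 by rewrite subr_gt0.
apply: le_trans (bern m); apply: le_trans (_ : (r^-1 - 1) *+ m <= _); last by rewrite lerDr.
rewrite -mulr_natl -ler_pdivrMr//; apply: le_trans (ltW (truncnS_gt _)) _.
by rewrite ler_nat.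
Qed.

Section SubstitutionalPattern.
Variables (R : realType) (E : zmodType) (V H : normedModType R).
Variables (G : zmodClosed E) (pv : {additive E -> V}) (ph : {additive E -> H}).
Hypothesis LS : lattice_scheme G pv ph.
Variables (l : nat) (W : 'I_l -> set H) (rho : R) (i0 : 'I_l) (s : H).
Hypothesis W_bounded : forall i h, W i h -> `|h| <= rho.
Hypothesis W_regular : regular_window (W i0).
Hypothesis W_generic : generic_shift G ph W s.
Variables (P P' : multiset V l).
Hypothesis P_hull : LI P (model_set G pv ph W s).
Hypothesis PP' : LI P P'.
Hypothesis P'P : LI P' P.
Variables (L L' : {additive V -> V}) (N : V -> R) (cL r C : R).
Hypothesis LK : cancel L L'.
Hypothesis L'K : cancel L' L.
Hypothesis L_bounded : forall x, `|L x| <= cL * `|x|.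
Hypothesis cL0 : 0 <= cL.
Hypothesis r01 : 0 < r < 1.
Hypothesis C0 : 0 <= C.
Hypothesis N_sub : forall x y, N (x - y) <= N x + N y.
Hypothesis N_L' : forall x, N (L' x) <= r * N x.
Hypothesis N_norm : forall x, `|x| <= N x <= C * `|x|.
Hypothesis L_MLD : MLD (image_multiset L P') P.

Lemma image_multisetE i x : image_multiset L P' i x <-> P' i (L' x).
Proof.
split=> [[y Py <-]|Px]; first by rewrite LK.
by exists (L' x).
Qed.

(** Take [g1] with internal part close to that of [g] divided by [n]. The precision [e / 2 / n]
    keeps the error below [e] after multiplication by [n]. *)
Lemma slab_generates (e : R) g : 0 < e -> g \in G ->
  exists g1, exists2 n, g1 \in G & `|ph g1| < e /\ `|ph (g - g1 *+ n)| < e.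
Proof.
move=> e0 gG.
pose n := (Num.trunc (2 * `|ph g| / e)).+1.
have n0 : 0 < n%:R :> R by rewrite ltr0n.
have d0 : 0 < e / 2 / n%:R by rewrite !divr_gt0.
have gn : n%:R^-1 * `|ph g| < e / 2.
  rewrite mulrC ltr_pdivrMr// mulrC -ltr_pdivrMr; last lra.
  by rewrite invf_div mulrA (mulrC `|_|); exact: truncnS_gt.
have [g1 g1G Hg1] := scheme_dense LS (n%:R^-1 *: ph g) d0.
have n1 : 1 <= n%:R :> R by rewrite ler1n.
have d1 : e / 2 / n%:R <= e / 2 by rewrite ler_pdivrMr// ler_peMr//; lra.
exists g1, n => //; split.
  have -> : ph g1 = n%:R^-1 *: ph g - (n%:R^-1 *: ph g - ph g1).
    by rewrite opprB addrC subrK.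
  apply: le_lt_trans (ler_normB _ _) _.
  have -> : `|n%:R^-1 *: ph g| = n%:R^-1 * `|ph g|.
    by rewrite normrZ ger0_norm// invr_ge0 ltW.
  lra.
rewrite raddfB raddfMn.
have -> : ph g - ph g1 *+ n = n%:R *: (n%:R^-1 *: ph g - ph g1).
  by rewrite scalerBr scalerA mulfV ?gt_eqF// scale1r scaler_nat.
rewrite normrZ gtr0_norm// mulrC -ltr_pdivlMr//; apply: lt_le_trans Hg1 _.
by rewrite ler_pM2r ?invr_gt0//; lra.
Qed.

(** Uses that [L P'] is derivable from [P]: [L] stretches the [r1]-ball by at most [cL], and [c] is
    the derivation radius. *)
Lemma return_vector_contract (r1 : R) : exists r2 : R, forall v,
  return_vector P [set t | `|t| <= r2] v ->
  return_vector P [set t | `|t| <= r1] (L' v).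
Proof.
have [_ /locally_derivableP[c c0 Hc]] := L_MLD.
exists (cL * `|r1| + c) => v [x sx].
apply: (LI_return_vector P'P (r := r1)) => //; exists (L' x).
have D y z : same_patch P [set t | `|t| <= cL * `|r1| + c] y z ->
    forall i u, `|u| <= r1 -> P' i (L' y + u) -> P' i (L' z + u).
  move=> syz i u ur; have uE w : L' w + u = L' (w + L u) by rewrite raddfD LK.
  rewrite !uE -!image_multisetE; apply: Hc => j t /= tc; rewrite -!addrA; apply: syz => /=.
  apply: le_trans (ler_normD _ _) _; apply: lerD => //.
  apply: le_trans (L_bounded u) _; rewrite ler_wpM2l//.
  exact: le_trans ur (ler_norm _).
move=> i u ur; rewrite -raddfD; split; apply: D => //.
by move=> j t tr; apply: iff_sym; exact: sx.
Qed.

(** Uses that [P] is derivable from [L P']. The point of [N] is the factor [r]: pulling the enlarged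
    ball of radius [a + c] back by [L'] shrinks it in one step. *)
Lemma return_vector_expand : exists2 c : R, 0 <= c & forall (a : R) v,
  return_vector P [set t | N t <= r * (a + c)] v ->
  return_vector P [set t | N t <= a] (L v).
Proof.
have [/locally_derivableP[c c0 Hc] _] := L_MLD.
exists (C * c); first exact: mulr_ge0.
move=> a v rv.
have [|x sx] := LI_return_vector (r := r * (a + C * c)) PP' _ rv.
  by move=> t; apply: le_trans; case/andP: (N_norm t).
exists (L x).
have D y z : same_patch P' [set t | N t <= r * (a + C * c)] y z ->
    forall i t, N t <= a -> P i (L y + t) -> P i (L z + t).
  move=> syz i t ta; apply: Hc => j u /= uc.
  have uE w : L' (L w + t + u) = w + L' (t + u) by rewrite -addrA raddfD LK.
  rewrite !image_multisetE !uE; apply: syz => /=.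
  apply: le_trans (N_L' _) _; rewrite ler_wpM2l//; first by case/andP: r01 => /ltW.
  rewrite -{1}(opprK u); apply: le_trans (N_sub _ _) _; apply: lerD => //.
  have /andP[_] := N_norm (- u); rewrite normrN => /le_trans; apply.
  by rewrite ler_wpM2l.
move=> i t ta; rewrite -raddfD; split; apply: D => //.
by move=> j u ur; apply: iff_sym; exact: sx.
Qed.

Lemma return_vector_expand_iter : exists c : R, forall m v,
  return_vector P [set t | N t <= c + 1] v ->
  return_vector P [set t | N t <= c + (r ^+ m)^-1] (iter m L v).
Proof.
have [c c0 Hc] := return_vector_expand; case/andP: r01 => r0 r1.
(* The fixed point of [t = r * (t + c)]; the excess of the radius over it is multiplied by [1 / r]
   at each step. *)
exists (r * c / (1 - r)); elim=> [|m IH] v; first by rewrite expr0 invr1.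
move=> /IH; rewrite iterS => rv; apply: Hc.
suff -> : r * (r * c / (1 - r) + (r ^+ m.+1)^-1 + c) = r * c / (1 - r) + (r ^+ m)^-1 by [].
rewrite exprS invfM; field.
by rewrite expf_neq0 ?gt_eqF//= subr_gt0.
Qed.

Let small_ball (a : R) : exists2 e : R, 0 < e & forall g, g \in G -> `|ph g| < e ->
  return_vector P [set t | N t <= a] (pv g).
Proof.
apply: (small_return_vector LS W_bounded W_generic P_hull (r := a)) => t.
by apply: le_trans; case/andP: (N_norm t).
Qed.

Let ball_small (eta : R) : 0 < eta -> exists a : R, forall v,
  return_vector P [set t | N t <= a] v -> exists2 g, g \in G & pv g = v /\ `|ph g| < eta.
Proof.
move=> eta0; have [c Hc] := return_vector_small LS W_bounded s W_regular eta0.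
exists (C * `|c|) => v [x sx]; apply: (Hc P P_hull); exists x => i t /= tc.
apply: sx => /=; have /andP[_ /le_trans] := N_norm t; apply.
by rewrite ler_wpM2l// (le_trans tc)// ler_norm.
Qed.

Lemma expand_slab (eta : R) : 0 < eta -> exists2 e : R, 0 < e &
  forall g, g \in G -> `|ph g| < e ->
    exists2 g', g' \in G & pv g' = L (pv g) /\ `|ph g'| < eta.
Proof.
move=> eta0; have [a Ha] := ball_small eta0.
have [c c0 Hc] := return_vector_expand.
have [e e0 He] := small_ball (r * (a + c)).
by exists e => // g gG ge; apply/Ha/Hc/He.
Qed.

(** The order of quantifiers matters: the slab is fixed before [eta], and [m0] serves all its
    lattice points at once. *)
Lemma expand_slab_iter : exists2 e : R, 0 < e & forall eta : R, 0 < eta ->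
  exists m0, forall m, (m0 <= m)%N -> forall g, g \in G -> `|ph g| < e ->
    exists2 g', g' \in G & pv g' = iter m L (pv g) /\ `|ph g'| < eta.
Proof.
have [c Hc] := return_vector_expand_iter.
have [e e0 He] := small_ball (c + 1); exists e => // eta eta0.
have [a Ha] := ball_small eta0.
have [m0 Hm0] := expr_inv_unbounded (a - c) r01.
exists m0 => m /Hm0 acm g gG ge.
have [x sx] := Hc m _ (He g gG ge); apply: Ha; exists x => i t /= ta.
by apply: sx => /=; apply: le_trans ta _; lra.
Qed.

Lemma contract_slab : exists2 e : R, 0 < e &
  forall g, g \in G -> `|ph g| < e -> exists2 g', g' \in G & pv g' = L' (pv g).
Proof.
have [c Hc] := return_vector_small LS W_bounded s W_regular ltr01.
have [r2 Hr2] := return_vector_contract c.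
have [e e0 He] := small_return_vector LS W_bounded W_generic P_hull
  (S := [set t | `|t| <= r2]) (r := r2) (fun t tr => tr).
exists e => // g gG ge.
by have [g' g'G [g'v _]] := Hc P P_hull _ (Hr2 _ (He g gG ge)); exists g'.
Qed.

Let slab_extend (f : {additive V -> V}) (e : R) : 0 < e ->
  (forall g, g \in G -> `|ph g| < e -> exists2 g', g' \in G & pv g' = f (pv g)) ->
  forall g, g \in G -> exists2 g', g' \in G & pv g' = f (pv g).
Proof.
move=> e0 Hf g gG; have [g1 [n g1G [g1e g2e]]] := slab_generates e0 gG.
have [h1 h1G h1E] := Hf g1 g1G g1e.
have [|h2 h2G h2E] := Hf (g - g1 *+ n) _ g2e; first by rewrite rpredB ?rpredMn.
exists (h2 + h1 *+ n); first by rewrite rpredD ?rpredMn.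
by rewrite raddfD raddfMn h1E h2E -raddfMn -raddfD -raddfMn -raddfD subrK.
Qed.

Lemma lattice_stable g : g \in G -> exists2 g', g' \in G & pv g' = L (pv g).
Proof.
have [e e0 He] := expand_slab ltr01; apply: (slab_extend e0) => {}g gG ge.
by have [g' g'G [g'E _]] := He g gG ge; exists g'.
Qed.

Lemma lattice_costable g : g \in G -> exists2 g', g' \in G & pv g' = L' (pv g).
Proof. by have [e e0 He] := contract_slab; apply: (slab_extend e0). Qed.

End SubstitutionalPattern.

(** * Self-affine windows *)

Section Iterates.
Variables (U : zmodType) (f f' : {additive U -> U}).

Lemma iter_raddfD m x y : iter m f (x + y) = iter m f x + iter m f y.
Proof. by elim: m => //= m ->; rewrite raddfD. Qed.

Lemma iter_raddfB m x y : iter m f (x - y) = iter m f x - iter m f y.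
Proof. by elim: m => //= m ->; rewrite raddfB. Qed.

Lemma iter_cancel m : cancel f f' -> cancel (iter m f) (iter m f').
Proof. by move=> fK; elim: m => // m IH x; rewrite iterSr iterS fK IH. Qed.

End Iterates.

Lemma nat_finType_collision (T : finType) (f : nat -> T) :
  exists n q, (0 < q)%N /\ f n = f (n + q)%N.
Proof.
pose g (i : 'I_#|T|.+1) := f i.
have /injectivePn[i [j ij gij]] : ~~ injectiveb g.
  apply/injectiveP => /leq_card; by rewrite card_ord ltnn.
wlog : i j ij gij / (i < j)%N => [H|ltij].
  have [|ji|/val_inj ji] := ltngtP i j; first exact: H.
    by apply: (H j i) => //; rewrite eq_sym.
  by rewrite ji eqxx in ij.
by exists i, (j - i)%N; rewrite subn_gt0 subnKC ?(ltnW ltij).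
Qed.

Section SelfAffineWindow.
Variables (R : realType) (E : zmodType) (V H : normedModType R).
Variables (G : zmodClosed E) (pv : {additive E -> V}) (ph : {additive E -> H}).
Hypothesis LS : lattice_scheme G pv ph.
Variables (A A' : {additive H -> H}) (cA' : R) (N : H -> R) (r C : R).
Hypothesis AK : cancel A A'.
Hypothesis A'K : cancel A' A.
Hypothesis cA'0 : 0 <= cA'.
Hypothesis A'_bounded : forall x, `|A' x| <= cA' * `|x|.
Hypothesis r01 : 0 < r < 1.
Hypothesis C0 : 0 <= C.
Hypothesis N_sub : forall x y, N (x - y) <= N x + N y.
Hypothesis N_A : forall x, N (A x) <= r * N x.
Hypothesis N_norm : forall x, `|x| <= N x <= C * `|x|.

Let A_bounded x : `|A x| <= r * C * `|x|.
Proof.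
have /andP[H1 _] := N_norm (A x); apply: le_trans H1 (le_trans (N_A x) _).
by rewrite -mulrA ler_wpM2l ?(ltW (proj1 (andP r01)))//; case/andP: (N_norm x).
Qed.

Let A'_small x (e : R) : 0 < e -> `|x| < e / (cA' + 1) -> `|A' x| < e.
Proof.
move=> e0; rewrite ltr_pdivlMr ?ltr_wpDl// => xe.
by apply: le_lt_trans (A'_bounded x) _; have := normr_ge0 x; nra.
Qed.

Let A_small x (e : R) : 0 < e -> `|x| < e / (r * C + 1) -> `|A x| < e.
Proof.
have rC : 0 <= r * C by rewrite mulr_ge0//; case/andP: r01 => /ltW.
move=> e0; rewrite ltr_pdivlMr ?ltr_wpDl// => xe.
by apply: le_lt_trans (A_bounded x) _; have := normr_ge0 x; nra.
Qed.

(** The union of the sets [A X + ph z], with [A X] written as a preimage under [A']. *)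
Definition hutchinson (Z : seq E) (X : set H) : set H :=
  [set x | exists2 z, z \in Z & X (A' (x - ph z))].

(* The window is the closure of the increasing union of the iterates of the
   open unit ball, which is open and invariant; no fixed point theorem is
   needed, and regularity is automatic. *)
Lemma self_affine_window : exists Z : seq E, exists K : set H,
  [/\ forall z, z \in Z -> z \in G, regular_window K & K = hutchinson Z K].
Proof.
have d1 : 0 < 1 / (cA' + 1) by rewrite divr_gt0// ltr_wpDl.
(* Every point of the unit ball is brought so close to 0 that [A'] keeps it in the ball; hence the
   iterates increase. *)
have [F [FG HF]] := lattice_net LS 1 0 d1.
pose Z := [seq - f | f <- F]; pose B := [set x : H | `|x| < 1].
pose O n := iter n (hutchinson Z) B; pose K := closure (\bigcup_n O n).
have B_sub : B `<=` hutchinson Z B.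
  move=> x /ltW/HF[f fF Hf]; exists (- f); first exact: map_f.
  by rewrite raddfN opprK; apply: A'_small; rewrite ?subr0 in Hf *.
have hut_mono X Y : X `<=` Y -> hutchinson Z X `<=` hutchinson Z Y.
  by move=> XY x [z zZ /XY]; exists z.
have O_mono n : O n `<=` O n.+1.
  by elim: n => [|n IH]; [exact: B_sub|exact: hut_mono].
have O_open n : open (O n).
  elim: n => [|n /open_normP IH]; apply/open_normP => x.
    move=> /= Bx; exists (1 - `|x|); first by rewrite subr_gt0.
    by move=> y xy; have := ler_normB x (x - y); rewrite opprB addrC subrK /B /=; lra.
  move=> [z zZ /IH[e e0 He]]; exists (e / (cA' + 1)).
    by rewrite divr_gt0// ltr_wpDl.
  move=> y xy; exists z => //; apply: He; rewrite -raddfB; apply: A'_small => //.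
  by rewrite opprB addrA subrK.
have [zeta zeta0 Hzeta] := seq_common_bound Z (fun z => N (ph (- z))).
case/andP: (r01) => r0 r1; have r1' : 0 < 1 - r by rewrite subr_gt0.
(* [C] bounds [N] on the unit ball, and [r * D + zeta <= D]. *)
pose D := C + zeta / (1 - r).
have zr0 : 0 <= zeta / (1 - r) by rewrite divr_ge0// ltW.
have O_N n x : O n x -> N x <= D.
  elim: n x => [x /= Bx|n IH x [z zZ /IH Nx]].
    have /andP[_ Nx] := N_norm x; apply: le_trans Nx _.
    rewrite /B /= in Bx; apply: (@le_trans _ _ C); last by rewrite lerDl.
    by rewrite ler_piMr// ltW.
  have -> : x = A (A' (x - ph z)) - ph (- z) by rewrite A'K raddfN opprK subrK.
  apply: le_trans (N_sub _ _) _; apply: le_trans (lerD (N_A _) (Hzeta _ zZ)) _.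
  have -> : zeta = zeta / (1 - r) * (1 - r) by rewrite divfK// gt_eqF.
  have : r * N (A' (x - ph z)) <= r * D by rewrite ler_wpM2l// ltW.
  have : r * C <= C by rewrite ler_piMl// ltW.
  by rewrite /D mulrDr; lra.
have O_bnd x : (\bigcup_n O n) x -> `|x| <= D.
  by move=> [n _ /O_N]; apply: le_trans; case/andP: (N_norm x).
have K_bnd x : K x -> `|x| <= D.
  move=> /closure_normP Kx; rewrite leNgt; apply/negP => xD.
  have [|y /O_bnd yD xy] := Kx (`|x| - D); first by rewrite subr_gt0.
  by have := ler_normD (x - y) y; rewrite subrK; lra.
have O_hut : \bigcup_n O n = hutchinson Z (\bigcup_n O n).
  apply/seteqP; split=> x.
    by move=> [n _ /O_mono[z zZ Oz]]; exists z => //; exists n.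
  by move=> [z zZ [n _ On]]; exists n.+1 => //; exists z.
have openO : open (\bigcup_n O n) by apply: bigcup_open.
have O_int : \bigcup_n O n `<=` interior K.
  by rewrite -open_subsetE//; exact: subset_closure.
have closedK : closed K by exact: closed_closure.
exists Z, K; split.
- by move=> _ /mapP[f /FG fG ->]; rewrite rpredN.
- split.
  + by apply: (scheme_compact LS) => //; apply/bounded_set_normP; exists D.
  + apply/seteqP; split; first exact: closureS.
    move=> x /closure_normP Kx; move/closed_normP: closedK; apply => e.
    by move=> /Kx[y /interior_subset Ky xy]; exists y.
  + exists 0; apply: subset_closure; exists 0%N => //=.
    by rewrite /B /= normr0.
apply/seteqP; split=> x.
  move=> Kx; apply: contrapT => noz.
  (* Closure commutes with the union since [Z] is finite: one radius serves for all the pieces that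
     miss [x]. *)
  have [||e e0 He] := @seq_common_radius R E Z (fun z e =>
    forall y, `|A' (x - ph z) - y| < e -> ~ (\bigcup_n O n) y).
  + by move=> z d e de He y yd; apply: He; exact: lt_le_trans yd de.
  + move=> z zZ; apply: contrapT => noe; apply: noz; exists z => //.
    apply/closure_normP => e e0; apply: contrapT => noy; apply: noe; exists e => //.
    by move=> y yd Oy; apply: noy; exists y.
  have e1 : 0 < e / (cA' + 1) by rewrite divr_gt0// ltr_wpDl.
  move/closure_normP: Kx => /(_ _ e1)[y]; rewrite O_hut => -[z zZ Oz] xy.
  apply: (He z zZ) Oz; rewrite -raddfB; apply: A'_small => //.
  by rewrite opprB addrA subrK.
move=> [z zZ /closure_normP Kz]; apply/closure_normP => e e0.
have rC : 0 <= r * C by rewrite mulr_ge0// ltW.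
have e1 : 0 < e / (r * C + 1) by rewrite divr_gt0// ltr_wpDl.
have [y Oy zy] := Kz _ e1; exists (A y + ph z).
  by rewrite O_hut; exists z => //; rewrite addrK AK.
have -> : x - (A y + ph z) = A (A' (x - ph z) - y).
  by rewrite raddfB A'K opprD addrA addrAC.
exact: A_small.
Qed.

End SelfAffineWindow.

(** * Local derivation of the image of a self-affine window *)

Section Derivation.
Variables (R : realType) (E : zmodType) (V H : normedModType R).
Variables (G : zmodClosed E) (pv : {additive E -> V}) (ph : {additive E -> H}).
Hypothesis LS : lattice_scheme G pv ph.

Lemma locally_derivable_union (X Y : set H) (F : seq E) (s : H) :
  (forall f, f \in F -> f \in G) ->
  (forall x, X x <-> exists2 f, f \in F & Y (x - ph f)) ->
  locally_derivable (model_set G pv ph (fun _ : 'I_1 => X) s)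
                    (model_set G pv ph (fun _ : 'I_1 => Y) s).
Proof.
move=> FG XY; have [M M0 HM] := seq_common_bound F (fun f => `|pv f|).
apply/locally_derivableP; exists M => // x y sp i [g [gG /= /XY[f fF Yf]] gx].
have fG := FG f fF.
have Px : model_set G pv ph (fun _ : 'I_1 => Y) s i (x + pv (- f)).
  rewrite -gx -raddfD; apply/(model_setE LS); first by rewrite rpredB.
  by rewrite raddfB addrAC.
have [|H1 _] := sp i (pv (- f)); first by rewrite /= raddfN normrN HM.
have [h [hG Yh] hy] := H1 Px.
have -> : y = pv (h + f) by rewrite raddfD hy raddfN subrK.
apply/(model_setE LS); first exact: rpredD.
by apply/XY; exists f; rewrite // raddfD addrAC addrK.
Qed.

Variables (M M' : {additive E -> E}) (L' : {additive V -> V}) (A A' : {additive H -> H}).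
Variables (cA' r C : R) (N : V -> R).
Hypothesis MK : cancel M M'.
Hypothesis M'K : cancel M' M.
Hypothesis MG : forall g, g \in G -> M g \in G.
Hypothesis M'G : forall g, g \in G -> M' g \in G.
Hypothesis AK : cancel A A'.
Hypothesis A'K : cancel A' A.
Hypothesis phM : forall g, ph (M g) = A (ph g).
Hypothesis pvM' : forall g, pv (M' g) = L' (pv g).
Hypothesis cA'0 : 0 <= cA'.
Hypothesis A'_bounded : forall x, `|A' x| <= cA' * `|x|.
Hypothesis r01 : 0 < r < 1.
Hypothesis N_sub : forall x y, N (x - y) <= N x + N y.
Hypothesis N_L' : forall x, N (L' x) <= r * N x.
Hypothesis N_norm : forall x, `|x| <= N x <= C * `|x|.
Variables (Z : seq E) (K : set H).
Hypothesis ZG : forall z, z \in Z -> z \in G.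
Hypothesis K_regular : regular_window K.
Hypothesis K_invariant : K = hutchinson ph A' Z K.

(** The sums of [M^i z_i] over [i < n]. The pieces of level [n] of [K] are the sets
    [A^n K + ph w]. *)
Fixpoint digits n : seq E :=
  if n is n'.+1 then [seq w + iter n' M z | w <- digits n', z <- Z] else [:: 0].

Lemma phM_iter n g : ph (iter n M g) = iter n A (ph g).
Proof. by elim: n => //= n <-. Qed.

Lemma iter_lattice n g : g \in G -> iter n M g \in G.
Proof. by move=> gG; elim: n => //= n; exact: MG. Qed.

Lemma digits_lattice n w : w \in digits n -> w \in G.
Proof.
elim: n w => [|n IH] w /=; first by rewrite inE => /eqP ->; rewrite rpred0.
move=> /allpairsP[[u z] /= [/IH uG zZ ->]].
by rewrite rpredD// iter_lattice// ZG.
Qed.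

Lemma window_digits n x :
  K x <-> exists2 w, w \in digits n & K (iter n A' (x - ph w)).
Proof.
elim: n => [|n IH] /=.
  split=> [Kx|[w]]; last by rewrite inE => /eqP ->; rewrite raddf0 subr0.
  by exists 0; rewrite ?mem_head// raddf0 subr0.
have step w z : A' (iter n A' (x - ph w) - ph z) =
    A' (iter n A' (x - ph (w + iter n M z))).
  rewrite (raddfD ph) opprD addrA (iter_raddfB _ _ _ (ph (iter n M z))).
  by rewrite phM_iter (iter_cancel n AK).
split=> [/IH[w wn]|[_ /allpairsP[[w z] /= [wn zZ ->]] Kx]].
  rewrite {1}K_invariant => -[z zZ]; rewrite step => Kz.
  by exists (w + iter n M z) => //; apply/allpairsP; exists (w, z).
apply/IH; exists w => //; rewrite K_invariant; exists z => //.
by rewrite step.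
Qed.

Lemma digits_neighbours : exists b : R, forall n w w2,
  w \in digits n -> w2 \in digits n -> `|pv (iter n M' (w2 - w))| <= b.
Proof.
have [zeta zeta0 Hzeta] := seq_common_bound [seq (z, z2) | z <- Z, z2 <- Z]
  (fun zz => N (pv (zz.1 - zz.2))).
case/andP: r01 => r0 r1; have r1' : 0 < 1 - r by rewrite subr_gt0.
(* The first term is the fixed point of [b = r * (b + zeta)], the recursion from one level to the
   next; the second covers level 0. *)
pose b := r * zeta / (1 - r) + `|N 0|.
have bE : r * (b + zeta) <= b.
  have -> : r * (b + zeta) = r * zeta / (1 - r) + r * `|N 0|.
    by rewrite /b; field; rewrite gt_eqF.
  by rewrite lerD2l ler_piMl// ltW.
have b0 : N 0 <= b.
  apply: le_trans (ler_norm _) _; rewrite lerDr.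
  by rewrite divr_ge0 ?mulr_ge0// ltW.
exists b => n w w2 wn w2n.
suff : N (pv (iter n M' (w2 - w))) <= b.
  by apply: le_trans; case/andP: (N_norm (pv (iter n M' (w2 - w)))).
elim: n w w2 wn w2n => [|n IH] w w2 /=.
  by rewrite !inE => /eqP -> /eqP ->; rewrite subrr raddf0.
move=> /allpairsP[[u z] /= [un zZ ->]] /allpairsP[[u2 z2] /= [u2n z2Z ->]].
rewrite pvM'; apply: le_trans (N_L' _) _.
have -> : u2 + iter n M z2 - (u + iter n M z) = (u2 - u) - iter n M (z - z2).
  by rewrite iter_raddfB opprB opprD addrACA.
rewrite iter_raddfB (iter_cancel n MK) raddfB.
have zz : N (pv (z - z2)) <= zeta.
  by apply: (Hzeta (z, z2)); apply/allpairsP; exists (z, z2).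
have H1 := N_sub (pv (iter n M' (u2 - u))) (pv (z - z2)).
have H2 := IH _ _ un u2n.
apply: le_trans bE; rewrite ler_wpM2l ?(ltW r0)//.
by apply: le_trans H1 _; apply: lerD.
Qed.

(** The rescaled difference [h] of two digits has physical part bounded by [digits_neighbours], and
    internal part bounded because [y] and [y - ph h] are. So [F] does not depend on the level. *)
Lemma window_neighbours (c0 : R) : exists F : seq E, forall n w y,
  w \in digits n -> `|y| <= c0 ->
  (K (ph w + iter n A y) <->
   exists2 h, h \in F & w + iter n M h \in digits n /\ K (y - ph h)).
Proof.
have [cK _ _] := K_regular; have [kappa Hkappa] := compact_norm_bounded cK.
have [b Hb] := digits_neighbours.
have [F HF] := scheme_finite LS (`|b| + `|c0| + `|kappa|).
exists F => n w y wn yc; split=> [/(window_digits n)[w2 w2n]|[h hF [hn Kh]]].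
  pose h := iter n M' (w2 - w).
  have whE : w + iter n M h = w2.
    by rewrite /h (iter_cancel n M'K) addrC subrK.
  have -> : iter n A' (ph w + iter n A y - ph w2) = y - ph h.
    rewrite -whE raddfD opprD addrACA subrr add0r.
    by rewrite phM_iter -iter_raddfB (iter_cancel n AK).
  move=> Kh; exists h; last by rewrite whE.
  have hG : h \in G.
    have : w2 - w \in G by rewrite rpredB// (digits_lattice w2n, digits_lattice wn).
    by rewrite /h; elim: (n) => //= m IH /IH; exact: M'G.
  have := ler_norm b; have := ler_norm c0; have := ler_norm kappa.
  have := normr_ge0 b; have := normr_ge0 c0; have := normr_ge0 kappa.
  move=> ? ? ? ? ? ?; apply: HF => //.
    by have := Hb n w w2 wn w2n; lra.
  have := ler_normB y (y - ph h); rewrite opprB addrC subrK.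
  by have := Hkappa _ Kh; lra.
apply/(window_digits n); exists (w + iter n M h) => //.
by rewrite raddfD opprD addrACA subrr add0r phM_iter -iter_raddfB (iter_cancel n AK).
Qed.

(* Up to the scaling by [M ^ n] there are finitely many types of neighbourhood
   of a level [n] piece of the window, so two levels have the same types. *)
Lemma neighbour_types_recur (F : seq E) : exists n q, (0 < q)%N /\
  forall w, w \in digits n -> exists2 w', w' \in digits (n + q) &
    forall h, h \in F -> (w + iter n M h \in digits n) =
                         (w' + iter (n + q) M h \in digits (n + q)).
Proof.
pose T n w : (size F).-tuple bool :=
  [tuple of map (fun h => w + iter n M h \in digits n) (in_tuple F)].
have [n [q [q0 Tq]]] := nat_finType_collision
  (fun n => [set t in [seq T n w | w <- digits n]]%SET).
exists n, q; split=> // w wn.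
have : T n w \in [set t in [seq T n w | w <- digits n]]%SET.
  by rewrite inE; apply: map_f.
rewrite Tq inE => /mapP[w' w'n TE]; exists w' => // h hF.
have hi : (index h F < size F)%N by rewrite index_mem.
have := congr1 (fun t : (size F).-tuple bool => nth false t (index h F)) TE.
by rewrite /= !(nth_map 0)// nth_index.
Qed.

Lemma window_power_derivable (s : H) : exists q, (0 < q)%N /\
  locally_derivable
    (model_set G pv ph (fun _ : 'I_1 => [set x | K (iter q A' x)]) s)
    (model_set G pv ph (fun _ : 'I_1 => K) s).
Proof.
have [cK _ _] := K_regular; have [kappa Hkappa] := compact_norm_bounded cK.
(* The extra 1 leaves room for a second point close to one in the piece. *)
have [F HF] := window_neighbours (kappa + 1).
have [n [q [q0 types]]] := neighbour_types_recur F.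
exists q; split=> //.
have /choice[next Hnext] : forall w, exists w', w \in digits n ->
    w' \in digits (n + q) /\ forall h, h \in F ->
    (w + iter n M h \in digits n) = (w' + iter (n + q) M h \in digits (n + q)).
  move=> w; have [wn|wn] := boolP (w \in digits n); last by exists 0.
  by have [w' H1 H2] := types w wn; exists w'.
(* Translation by [ph (jump w)] takes the surroundings of [A^q] of piece [w] to those of a piece of
   [K] of level [n + q] with the same neighbours. *)
pose jump w := next w - iter q M w.
have nextG w : w \in digits n -> jump w \in G.
  move=> wn; rewrite rpredB// ?iter_lattice//; last exact: digits_lattice wn.
  by have [/digits_lattice] := Hnext w wn.
have local w y : w \in digits n -> `|y| <= kappa + 1 ->
    let x := iter q A (ph w + iter n A y) in
    K (iter q A' x) <-> K (x + ph (jump w)).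
  move=> wn yk x; have [w'n Hw'] := Hnext w wn.
  rewrite /x (iter_cancel q AK) HF//.
  have -> : iter q A (ph w + iter n A y) + ph (jump w) =
      ph (next w) + iter (n + q) A y.
    rewrite iter_raddfD raddfB phM_iter addnC iterD addrC addrA.
    by rewrite subrK.
  rewrite HF//; split=> -[h hF [hn Kh]]; exists h => //; split=> //.
    by rewrite -Hw'.
  by rewrite Hw'.
have iter_bounded m : exists2 c : R, 0 <= c & forall x, `|iter m A' x| <= c * `|x|.
  elim: m => [|m [c c0 Hc]]; first by exists 1 => // x; rewrite mul1r.
  exists (cA' * c); first exact: mulr_ge0.
  by move=> x /=; apply: le_trans (A'_bounded _) _; rewrite -mulrA ler_wpM2l.
have [cm cm0 Hcm] := iter_bounded (n + q)%N.
(* Internal parts this close remain within 1 after [n + q] applications of [A']. *)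
have d0 : 0 < 1 / (cm + 1) by rewrite divr_gt0// ltr_wpDl.
(* Since [A^q K + ph w0] lies in [K], the patch at [a] shows a point at [a + pv w0]; so [b] too will
   be the projection of a lattice point. *)
have [w0 w0q] : exists w, w \in digits q.
  have [_ _ [x /(window_digits q)[w wq _]]] := K_regular; by exists w.
have into_K x : K (iter q A' x) -> K (x + ph w0).
  by move=> Kx; apply/(window_digits q); exists w0; rewrite // addrK.
have Hrho0 x : K (iter q A' x) -> `|x| <= kappa + `|ph w0|.
  move=> /into_K/Hkappa; have := ler_normB (x + ph w0) (ph w0).
  by rewrite addrK; lra.
have [S [SG HS]] := window_separation LS (kappa + `|ph w0|) K_regular d0.
pose all_shifts := w0 :: S ++ [seq jump w | w <- digits n].
have asG f : f \in all_shifts -> f \in G.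
  rewrite inE mem_cat => /or3P[/eqP ->|/SG//|/mapP[w wn ->]]; last exact: nextG.
  exact: digits_lattice w0q.
have [c c0 Hc] := seq_common_bound all_shifts (fun f => `|pv f|).
apply/locally_derivableP; exists c => // a b sp i [g [gG /= Kg] ga].
have w0S : w0 \in all_shifts by rewrite mem_head.
have [g' g'G g'b] : exists2 g', g' \in G & pv g' = b.
  have [H1 _] := sp i (pv w0) (Hc _ w0S).
  have [|h [hG _] hb] := H1.
    rewrite -ga -raddfD; apply/(model_setE LS); first by rewrite rpredD// asG.
    by rewrite raddfD addrAC; exact: into_K.
  by exists (h - w0); rewrite ?(rpredB hG) ?asG// raddfB hb addrK.
have code f : f \in all_shifts -> K (ph g - s + ph f) <-> K (ph g' - s + ph f).
  move=> fS; have := sp i (pv f) (Hc _ fS).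
  have fG := asG f fS; rewrite -ga -g'b -!raddfD.
  rewrite !(model_setE LS) ?rpredD// !raddfD.
  by rewrite !(addrAC _ (ph f)).
rewrite -g'b; apply/(model_setE LS) => //=.
have [near|far] := ltP `|ph g - s - (ph g' - s)| (1 / (cm + 1)); last first.
  have [f fS [H1 H2]] := HS _ _ (Hrho0 _ Kg) far.
  exfalso; apply: H2; apply/code => //.
  by rewrite inE mem_cat fS orbT.
(* Both internal parts now have bounded coordinates [y] and [y'] relative to the same piece [w], so
   [jump w] decides membership for both. *)
have [w wn Kw] := (window_digits n _).1 Kg.
have jS : jump w \in all_shifts by rewrite inE mem_cat map_f ?orbT.
pose y := iter n A' (iter q A' (ph g - s) - ph w).
pose y' := iter n A' (iter q A' (ph g' - s) - ph w).
have yE x : x = iter q A (ph w + iter n A (iter n A' (iter q A' x - ph w))).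
  by rewrite (iter_cancel n A'K) addrC subrK (iter_cancel q A'K).
have yk : `|y| <= kappa + 1 by have := Hkappa _ Kw; rewrite -/y; lra.
have y'k : `|y'| <= kappa + 1.
  have -> : y' = y - iter (n + q) A' (ph g - s - (ph g' - s)).
    rewrite iterD (iter_raddfB A' q) /y' /y -(iter_raddfB A' n); congr (iter n A' _).
    by rewrite opprB [RHS]addrC addrA subrK.
  apply: le_trans (ler_normB _ _) _; apply: lerD; first exact: Hkappa.
  apply: le_trans (Hcm _) _; move: near; rewrite ltr_pdivlMr ?ltr_wpDl//.
  by have := normr_ge0 (ph g - s - (ph g' - s)); lra.
rewrite (yE (ph g' - s)); apply/local => //; rewrite -yE; apply/code => //.
by rewrite (yE (ph g - s)); apply/local => //; rewrite -yE.
Qed.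

Lemma window_image_MLD (s : H) :
  MLD (model_set G pv ph (fun _ : 'I_1 => [set x | K (A' x)]) s)
      (model_set G pv ph (fun _ : 'I_1 => K) s).
Proof.
split.
  apply: (locally_derivable_union (F := Z)) => // x.
  by rewrite {1}K_invariant.
have [q [q0 Kq]] := window_power_derivable s.
(* Since the power is positive, the image under [A] of the level [q] decomposition of [K] writes
   [A K] by translates of [A^(q+1) K]. *)
case: q q0 Kq => // q _ Kq.
apply: locally_derivable_trans Kq.
apply: (locally_derivable_union (F := [seq M w | w <- digits q])).
  by move=> _ /mapP[w /digits_lattice wG ->]; exact: MG.
move=> x; rewrite /= (window_digits q); split.
  move=> [w wq Kw]; exists (M w); first exact: map_f.
  by rewrite -iterS iterSr raddfB phM AK.
move=> [_ /mapP[w wq ->] Kw]; exists w => //.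
by move: Kw; rewrite -iterS iterSr raddfB phM AK.
Qed.

End Derivation.

(** * Lattices and projections *)

Section Lattice.
Variables (R : realType) (k : nat) (G : zmodClosed 'rV[R]_k).
Local Notation E := 'rV[R]_k.
Hypothesis latG : full_rank_lattice G.

Lemma lattice_finite (r : R) : exists s : seq E, forall g, g \in G -> `|g| <= r -> g \in s.
Proof.
have [b /andP[_ freeb] HG] := latG.
have coord_bnd i : exists2 c, 0 <= c & forall x : E, `|coord b i x| <= c * `|x|.
  exact: (@row_linear_bounded R _ R^o (coord b i)).
pose c := \sum_i s2val (cid2 (coord_bnd i)).
have cE i x : `|coord b i x| <= c * `|x|.
  rewrite /c (bigD1 i)//= mulrDl; case: cid2 => ci ci0 Hci.
  apply: le_trans (Hci x) _; rewrite lerDl mulr_ge0// sumr_ge0// => j _.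
  by case: cid2.
have c0 : 0 <= c by rewrite sumr_ge0// => i _; case: cid2.
pose B := (Num.trunc (c * `|r|)).+1.
(* Integer coordinates between [-B] and [B] are stored with offset [B], so that [pt] has finite
   image. *)
pose pt (f : {ffun 'I_(\dim {:E}) -> 'I_(B + B).+1}) : E :=
  \sum_(i < \dim {:E}) b`_i *~ ((f i)%:Z - B%:Z).
exists (codom pt) => g gG gr; have [a aE] := (HG g).1 gG.
have aB i : `|a i| <= B%:Z.
  rewrite -(ler_int R) intr_norm.
  have -> : (a i)%:~R = coord b i g.
    rewrite aE linear_sum /= (bigD1 i)//= big1 ?addr0 => [|j ji].
      by rewrite raddfMz /= coord_free// eqxx.
    by rewrite raddfMz /= coord_free// (negPf ji) mul0rz.
  apply: le_trans (cE i g) _; apply: ltW.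
  apply: le_lt_trans (truncnS_gt _); rewrite ler_wpM2l//.
  exact: le_trans gr (ler_norm r).
apply/codomP; exists [ffun i => inord (absz (a i + B%:Z)%R)].
rewrite aE; apply: eq_bigr => i _; congr (_ *~ _).
have := aB i; rewrite ler_norml => /andP[a1 a2].
rewrite ffunE inordK; first lia.
lia.
Qed.

Lemma lattice_cocompact : exists C : R, forall x : E, exists2 g, g \in G & `|g - x| <= C.
Proof.
have [b bb HG] := latG.
exists (\sum_(i < \dim {:E}) `|b`_i|) => x.
exists (\sum_(i < \dim {:E}) b`_i *~ Num.floor (coord b i x)).
  by apply/HG; exists (fun i => Num.floor (coord b i x)).
rewrite {2}(coord_basis bb (memvf x)) -sumrB.
apply: le_trans (ler_norm_sum _ _ _) _; apply: ler_sum => i _.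
rewrite -scaler_int -scalerBl normrZ ler_piMl// distrC ler_norml.
have := floor_le (coord b i x); have := lt_succ_floor (coord b i x).
rewrite intrD; lra.
Qed.

End Lattice.

Section Projections.
Variables (R : realType) (k : nat) (Ev Ei : {vspace 'rV[R]_k}).
Local Notation E := 'rV[R]_k.

Lemma phys_proj_linear : linear (phys_proj Ev Ei).
Proof. by move=> a x y; rewrite /phys_proj !linearP. Qed.

HB.instance Definition _ := GRing.isLinear.Build R E (subvs_of Ev) *:%R
  (phys_proj Ev Ei) phys_proj_linear.

Lemma int_proj_linear : linear (int_proj Ev Ei).
Proof. by move=> a x y; rewrite /int_proj !linearP. Qed.

HB.instance Definition _ := GRing.isLinear.Build R E (subvs_of Ei) *:%R
  (int_proj Ev Ei) int_proj_linear.

Hypothesis sumE : (Ev + Ei)%VS = fullv.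
Hypothesis capE : (Ev :&: Ei)%VS = 0%VS.

Let capE' : (Ei :&: Ev)%VS = 0%VS. Proof. by rewrite capvC. Qed.

Lemma proj_sum x : vsval (phys_proj Ev Ei x) + vsval (int_proj Ev Ei x) = x.
Proof.
rewrite /phys_proj /int_proj !vsprojK ?memv_pi //.
by rewrite daddv_pi_add // sumE memvf.
Qed.

Lemma phys_proj_phys (u : subvs_of Ev) : phys_proj Ev Ei (vsval u) = u.
Proof. by rewrite /phys_proj daddv_pi_id ?subvsP// vsvalK. Qed.

Lemma int_proj_int (u : subvs_of Ei) : int_proj Ev Ei (vsval u) = u.
Proof. by rewrite /int_proj daddv_pi_id ?subvsP// vsvalK. Qed.

Lemma int_proj_phys (u : subvs_of Ev) : int_proj Ev Ei (vsval u) = 0.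
Proof.
have := proj_sum (vsval u); rewrite phys_proj_phys => /eqP.
by rewrite -subr_eq0 addrAC subrr add0r => /eqP H; apply: (can_inj (@vsvalK _ _ _)); rewrite H linear0.
Qed.

Lemma phys_proj_int (u : subvs_of Ei) : phys_proj Ev Ei (vsval u) = 0.
Proof.
have := proj_sum (vsval u); rewrite int_proj_int => /eqP.
by rewrite -subr_eq0 addrK => /eqP H; apply: (can_inj (@vsvalK _ _ _)); rewrite H linear0.
Qed.

Lemma scheme_lattice_scheme (G : zmodClosed E) :
  cut_project_scheme Ev Ei G ->
  lattice_scheme G (phys_proj Ev Ei) (int_proj Ev Ei).
Proof.
move=> [_ _ _ latG pinj _ dens].
have [cp cp0 Hcp] := row_linear_bounded (phys_proj Ev Ei).
have [ci ci0 Hci] := row_linear_bounded (int_proj Ev Ei).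
split.
- move=> r; have [s Hs] := lattice_finite latG (r + r); exists s => g gG pr ir.
  apply: Hs => //; rewrite -(proj_sum g).
  by apply: le_trans (ler_normD _ _) _; apply: lerD.
- move=> h e e0; move/dense_normP: dens => /(_ h e e0)[_ [g gG <-] he].
  by exists g.
- move=> g gG /= g0; apply: pinj => //; first exact: rpred0.
  by rewrite g0 linear0.
- have [C HC] := lattice_cocompact latG.
  exists (cp * C + ci * C) => v h.
  have [g gG Hg] := HC (vsval v + vsval h); exists g => //=.
  have C0 : 0 <= C by apply: le_trans Hg.
  have pE : phys_proj Ev Ei (vsval v + vsval h) = v.
    by rewrite linearD /= phys_proj_phys phys_proj_int addr0.
  have iE : int_proj Ev Ei (vsval v + vsval h) = h.
    by rewrite linearD /= int_proj_phys int_proj_int add0r.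
  have cpC : cp * `|g - (vsval v + vsval h)| <= cp * C by rewrite ler_wpM2l.
  have ciC : ci * `|g - (vsval v + vsval h)| <= ci * C by rewrite ler_wpM2l.
  have cpC0 : 0 <= cp * C by rewrite mulr_ge0.
  have ciC0 : 0 <= ci * C by rewrite mulr_ge0.
  have := Hcp (g - (vsval v + vsval h)); have := Hci (g - (vsval v + vsval h)).
  by rewrite !linearB /= pE iE; lra.
- exact: subspace_bounded_closed_compact.
Qed.

End Projections.

Section WindowConversions.
Variables (R : realType) (k : nat) (Ev Ei : {vspace 'rV[R]_k}) (G : zmodClosed 'rV[R]_k).
Local Notation H := (subvs_of Ei).

Lemma nonsingular_generic l (W : 'I_l -> set H) s :
  nonsingular Ev G (shift_window W s) <-> generic_shift G (int_proj Ev Ei) W s.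
Proof.
split=> ns i.
  move=> g gG; apply: contrapT => /not_orP[nint /contrapT cl].
  suff : (@set0 H) (int_proj Ev Ei g) by [].
  rewrite -(ns i); split; first by exists g.
  by split; [exact/closure_translate|move=> /interior_translate].
apply/seteqP; split=> // _ [[g gG <-] [/closure_translate cl nint]].
by have [/interior_translate|] := ns i g gG.
Qed.

Lemma cut_project_model_set l (W : 'I_l -> set H) s :
  cut_project_set G (shift_window W s) =
  model_set G (phys_proj Ev Ei) (int_proj Ev Ei) W s.
Proof.
apply/funext => i; apply/seteqP; split=> _ [g [gG Wg] <-]; exists g => //;
  by split=> //; apply/translateE.
Qed.

Lemma is_window_regular l (W : 'I_l -> set H) : is_window W ->
  (exists i, regular_window (W i)) /\
  exists rho : R, forall i h, W i h -> `|h| <= rho.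
Proof.
move=> [HW [i Wi]]; split; first by exists i; case: (HW i).
have /choice[M HM] : forall j, exists M : R, forall h, W j h -> `|h| <= M.
  by move=> j; apply: compact_norm_bounded; case: (HW j).
exists (\sum_j `|M j|) => j h /HM/le_trans; apply.
rewrite (bigD1 j)//=; apply: le_trans (ler_norm _) _.
by rewrite lerDl sumr_ge0.
Qed.

End WindowConversions.

Section LinearAlgebra.
Variables (R : realType) (k : nat).
Local Notation E := 'rV[R]_k.
Implicit Types (U : {vspace E}) (M : 'End(E)).

Lemma lker0_bijective (V : vectType R) (f : 'End(V)) : lker f == 0%VS -> bijective f.
Proof.
by move=> kf; exists (f^-1)%VF; [exact: lker0_lfunK|exact: lker0_lfunVK].
Qed.

Lemma vsval_restr U M u : invariant_subspace M U -> vsval (restr U M u) = M (vsval u).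
Proof.
move=> inv; rewrite lfunE /= vsprojK//.
by apply: (subvP inv); rewrite memv_img// subvsP.
Qed.

End LinearAlgebra.

(** * From substitutions to hyperbolic automorphisms *)

Section FromSubstitution.
Variables (R : realType) (k : nat) (Ev Ei : {vspace 'rV[R]_k}) (G : zmodClosed 'rV[R]_k).
Local Notation E := 'rV[R]_k.
Local Notation pv := (phys_proj Ev Ei).
Local Notation ph := (int_proj Ev Ei).
Variables (L : 'End(subvs_of Ev)) (l : nat) (W : 'I_l -> set (subvs_of Ei)).
Hypothesis datum : substitutional_datum G L W.

Let scheme : cut_project_scheme Ev Ei G. Proof. by case: datum. Qed.
Let expL : expansive L. Proof. by case: datum. Qed.
Let LS := scheme_lattice_scheme (proj1 (scheme_complementary scheme))
  (proj2 (scheme_complementary scheme)) scheme.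
Let sumE := proj1 (scheme_complementary scheme).
Let capE := proj2 (scheme_complementary scheme).

(** All that is needed from the patterns; what follows uses only the lattice and linear algebra. *)
Lemma substitution_lattice_maps :
  [/\ forall g, g \in G -> exists2 g', g' \in G & pv g' = L (pv g),
      forall g, g \in G -> exists2 g', g' \in G & pv g = L (pv g'),
      exists2 e : R, 0 < e & forall g, g \in G -> `|ph g| < e ->
        exists2 g', g' \in G & pv g' = L (pv g) /\ `|ph g'| < 1 &
      exists2 e : R, 0 < e & forall eta : R, 0 < eta ->
        exists m0, forall m, (m0 <= m)%N -> forall g, g \in G -> `|ph g| < e ->
        exists2 g', g' \in G & pv g' = iter m L (pv g) /\ `|ph g'| < eta].
Proof.
case: datum => _ _ winW [P [s [/nonsingular_generic gs [_ PL]]] [bijL [P' [_ [P'P PP'] LMLD]]]].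
have [[i0 rW] [rho W_bnd]] := is_window_regular winW.
have [N [r [C [r01 C0 NB NL' Nn]]]] := contractive_adapted_norm (expansive_inv_contractive expL).
have [cL cL0 HcL] := @subspace_linear_bounded R k Ev (subvs_of Ev) L.
have kL := expansive_lker0 expL.
rewrite cut_project_model_set in PL.
have LK := lker0_lfunK kL; have L'K := lker0_lfunVK kL.
split.
- move=> g gG; exact: (lattice_stable LS W_bnd rW gs PL PP' LK L'K r01 C0 NB NL' Nn LMLD gG).
- move=> g gG.
  have [g' g'G g'E] := lattice_costable LS W_bnd rW gs PL P'P LK L'K HcL cL0 LMLD gG.
  by exists g'; rewrite // g'E L'K.
- exact: (expand_slab LS W_bnd rW gs PL PP' LK L'K r01 C0 NB NL' Nn LMLD ltr01).
- exact: (expand_slab_iter LS W_bnd rW gs PL PP' LK L'K r01 C0 NB NL' Nn LMLD).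
Qed.


(** [M] sends each vector of a lattice basis to a lattice point above its image under [L]. It is
    onto [G] because [L] has preimages there and [pv] is injective on [G]. *)
Lemma lattice_linear_extension : exists M : 'End(E),
  (forall x, pv (M x) = L (pv x)) /\ M @` [set` G] = [set` G].
Proof.
have [stab costab _ _] := substitution_lattice_maps.
have [b bb HG] := scheme_lattice scheme.
have freeb : free b by case/andP: bb.
have bG i : (i < \dim {:E})%N -> b`_i \in G.
  move=> ib; apply/HG; exists (fun j => (j == Ordinal ib)%:Z).
  rewrite (bigD1 (Ordinal ib))//= eqxx mulr1z big1 ?addr0// => j /negPf ->.
  by rewrite mulr0z.
have /choice[c Hc] : forall i : 'I_(\dim {:E}), exists c, c \in G /\ pv c = L (pv b`_i).
  by move=> i; have [c cG cE] := stab _ (bG i (ltn_ord i)); exists c.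
have [M0 HM0] := linear_of_free b [seq c i | i <- enum 'I_(\dim {:E})].
have {}HM0 (i : 'I_(\dim {:E})) : M0 b`_i = c i.
  have sz : size [seq c i | i <- enum 'I_(\dim {:E})] = size b.
    by rewrite size_map size_enum_ord size_tuple.
  have := congr1 (fun t => nth 0 t i) (HM0 freeb sz).
  rewrite (nth_map 0) ?size_tuple// (nth_map i) ?size_enum_ord//.
  by rewrite nth_ord_enum.
have pvM0 x : pv (M0 x) = L (pv x).
  rewrite {1 2}(coord_basis bb (memvf x)) !linear_sum /=; apply: eq_bigr => i _.
  by rewrite !linearZ /= HM0 (Hc i).2.
have M0G g : g \in G -> M0 g \in G.
  move=> /HG[a ->]; rewrite linear_sum; apply: rpred_sum => i _.
  by rewrite raddfMz rpredMz//= HM0 (Hc i).1.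
exists (linfun M0); split=> [x|]; first by rewrite lfunE.
apply/seteqP; split=> [_ [g gG <-]|g gG] /=; first by rewrite lfunE /= M0G.
have [g' g'G g'E] := costab g gG; exists g' => //; rewrite lfunE /=.
by apply: (pv_inj LS) => //; [exact: M0G|rewrite /= pvM0].
Qed.

Lemma lattice_preserving_bijective (M : 'End(E)) :
  M @` [set` G] = [set` G] -> lker M == 0%VS.
Proof.
move=> MG; have [b bb HG] := scheme_lattice scheme.
suff full : limg M = fullv.
  have := limg_ker_dim M fullv; rewrite capfv full => /eqP.
  by rewrite -{2}[\dim fullv]add0n eqn_add2r dimv_eq0.
apply/eqP; rewrite eqEsubv subvf /=; apply/subvP => v _.
rewrite (coord_basis bb (memvf v)) memv_suml// => -[i ib'] _ /=; rewrite memvZ//.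
have : [set` G] b`_i.
  apply/HG; exists (fun j => (j == Ordinal ib')%:Z).
  rewrite (bigD1 (Ordinal ib'))//= eqxx mulr1z big1 ?addr0// => j /negPf ->.
  by rewrite mulr0z.
by rewrite -MG => -[g _ <-]; rewrite memv_img ?memvf.
Qed.

(* Small internal parts stay bounded under [M], so the internal part of [M] on
   the physical space is a bounded, hence zero, linear map. *)
Lemma physical_invariant (M : 'End(E)) (v : subvs_of Ev) :
  (forall x, pv (M x) = L (pv x)) -> M @` [set` G] = [set` G] ->
  ph (M (vsval v)) = 0.
Proof.
move=> pvM MG.
have [_ _ [e e0 He] _] := substitution_lattice_maps.
have Mint g : g \in G -> `|ph g| < e -> `|ph (M g)| < 1.
  move=> gG ge; have [g' g'G [g'E g'1]] := He g gG ge.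
  suff <- : g' = M g by [].
  apply: (pv_inj LS); rewrite //= ?pvM//.
  have : [set` G] (M g) by rewrite -MG; exists g.
  by [].
have [rho Hrho] := lattice_relatively_dense LS 0 e0.
have [c c0 Hc] := row_linear_bounded (ph \o M).
apply/eqP; rewrite -normr_eq0; apply/eqP/le_anti; rewrite normr_ge0 andbT.
rewrite leNgt; apply/negP => v0.
(* A slab point lies within [rho + e] of [n v], so [n] times the internal part of [M v] is at most
   [1 + c * (rho + e)]; [n] is chosen to exceed this. *)
pose n := (Num.trunc ((1 + c * (rho + e)) / `|ph (M (vsval v))|)).+1.
have nb : 1 + c * (rho + e) < n%:R * `|ph (M (vsval v))|.
  by rewrite -ltr_pdivrMr//; exact: truncnS_gt.
have [g gG [gv]] := Hrho (v *+ n); rewrite subr0 => ge.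
have gE : `|g - vsval (v *+ n)| <= rho + e.
  rewrite -{1}(proj_sum sumE capE g) addrAC.
  apply: le_trans (ler_normD _ _) _; apply: lerD; last exact: ltW.
  by rewrite -linearB.
have := Hc (g - vsval (v *+ n)); rewrite /= !linearB /=.
have -> : ph (M (vsval (v *+ n))) = ph (M (vsval v)) *+ n by rewrite !raddfMn.
have := ler_normB (ph (M g)) (ph (M g) - ph (M (vsval v)) *+ n).
rewrite opprB addrC subrK normrMn -mulr_natl.
have : c * `|g - vsval (v *+ n)| <= c * (rho + e) by rewrite ler_wpM2l.
have := Mint g gG ge; lra.
Qed.

Lemma substitution_hyperbolic : exists M : 'End(E),
  [/\ hyperbolic_datum Ev G M, L = restr Ev M & contracting_subspace M Ei].
Proof.
have [M [pvM MG]] := lattice_linear_extension; exists M.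
have kM := lattice_preserving_bijective MG.
have phv (v : subvs_of Ev) : ph (M (vsval v)) = 0 := physical_invariant v pvM MG.
have invv : invariant_subspace M Ev.
  apply/subvP => _ /memv_imgP[x xv ->].
  have := proj_sum sumE capE (M x); have := phv (Subvs xv); rewrite /= => ->.
  by rewrite linear0 addr0 => <-; exact: subvsP.
(* [Ei] is the kernel of [pv], which intertwines [M] and [L]. *)
have invi : invariant_subspace M Ei.
  apply/subvP => _ /memv_imgP[x xi ->].
  have := proj_sum sumE capE (M x); rewrite pvM.
  have -> : x = vsval (Subvs xi) by [].
  by rewrite (phys_proj_int sumE capE) !linear0 add0r => <-; exact: subvsP.
have LE : L = restr Ev M.
  apply/lfunP => u; apply: (can_inj (@vsvalK _ _ _)).
  rewrite vsval_restr// -{1}(phys_proj_phys capE u) -pvM.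
  by have := proj_sum sumE capE (M (vsval u)); rewrite phv linear0 addr0.
pose A := restr Ei M.
have phM x : ph (M x) = A (ph x).
  rewrite -{1}(proj_sum sumE capE x) !linearD /= phv add0r -vsval_restr//.
  exact: int_proj_int.
have iterG m g : g \in G -> iter m M g \in G.
  move=> gG; elim: m => //= m IH.
  have : [set` G] (M (iter m M g)) by rewrite -MG; exists (iter m M g).
  by [].
have contrA : contractive A.
  apply: decay_contractive => x d d0.
  have [_ _ _ [e e0 He]] := substitution_lattice_maps.
  pose t := e / 2 / (`|x| + 1).
  have x1 : 0 < `|x| + 1 by rewrite ltr_wpDl.
  have t0 : 0 < t by rewrite !divr_gt0.
  have tx : `|t *: x| < e.
    rewrite normrZ gtr0_norm// /t mulrAC ltr_pdivrMr//.
    have := normr_ge0 x; nra.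
  have dt0 : 0 < d * t / 2 by rewrite !divr_gt0// mulr_gt0.
  have [m0 Hm0] := He _ dt0; exists m0 => m /Hm0 Hm.
  have [c c0 Hc] : exists2 c, 0 <= c & forall y, `|iter m A y| <= c * `|y|.
    elim: m {Hm} => [|m [c c0 Hc]]; first by exists 1 => // y; rewrite mul1r.
    have [c' c'0 Hc'] := @subspace_linear_bounded R k Ei (subvs_of Ei) A.
    exists (c' * c); first exact: mulr_ge0.
    by move=> y /=; apply: le_trans (Hc' _) _; rewrite -mulrA ler_wpM2l.
  have c1 : 0 < c + 1 by rewrite ltr_wpDl.
  (* With [m] fixed, [g] is chosen so close to [t *: x] that [A^m] keeps the error below
     [d * t / 2]; the slab estimate gives the other half. *)
  have d'0 : 0 < Num.min (e - `|t *: x|) (d * t / 2 / (c + 1)).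
    by rewrite lt_min subr_gt0 tx divr_gt0.
  have [g gG] := scheme_dense LS (t *: x) d'0.
  rewrite lt_min ltr_pdivlMr// => /andP[g1 g2].
  have ge : `|ph g| < e.
    have := ler_normB (t *: x) (t *: x - ph g); rewrite opprB addrC subrK; lra.
  have [g' g'G [g'E g'd]] := Hm g gG ge.
  have g'M : g' = iter m M g.
    apply: (pv_inj LS) => //; first exact: iterG.
    by rewrite [LHS]g'E; elim: (m) => //= j ->; rewrite pvM.
  have phMm : ph (iter m M g) = iter m A (ph g) by elim: (m) => //= j <-.
  rewrite g'M phMm in g'd.
  have : t * `|iter m A x| <= t * d.
    have <- : `|iter m A (t *: x)| = t * `|iter m A x|.
      rewrite -{2}(gtr0_norm t0) -normrZ; congr `|_|.
      by elim: (m) => //= j ->; rewrite linearZ.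
    have iterB y z : iter m A (y - z) = iter m A y - iter m A z.
      by elim: (m) => //= j ->; rewrite linearB.
    have := Hc (t *: x - ph g); rewrite iterB => H1.
    have := ler_normD (iter m A (t *: x) - iter m A (ph g)) (iter m A (ph g)).
    rewrite subrK; have := normr_ge0 (t *: x - ph g); nra.
  by rewrite ler_pM2l.
have eM : expansive (restr Ev M) by rewrite -LE.
have spM : hyperbolic_splitting M Ev Ei := And4 sumE (conj invv invi) eM contrA.
have cM : contracting_subspace M Ei := ex_intro _ Ev spM.
have hM : hyperbolic M.
  by split; [exact: lker0_bijective kM|exists Ev, Ei].
exact: And3 (And5 hM MG invv eM (ex_intro2 _ _ Ei cM sumE)) LE cM.
Qed.

End FromSubstitution.

(** * From hyperbolic automorphisms to substitutions *)

Section Torus.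
Variables (R : realType) (k : nat) (Ev : {vspace 'rV[R]_k}) (G : zmodClosed 'rV[R]_k).
Local Notation E := 'rV[R]_k.

Lemma torus_projP (x y : E) : torus_proj G x = torus_proj G y <-> x - y \in G.
Proof.
rewrite Quotient.idealrBE; split=> [xy|/eqP//]; exact/eqP.
Qed.

(** Density of [Ev + G], obtained by testing density in the torus on the image of the saturated open
    set [B + G]. *)
Lemma torus_dense : dense (torus_proj G @` [set` Ev]) ->
  forall (x : E) (e : R), 0 < e ->
  exists v g, [/\ v \in Ev, g \in G & `|x - (v + g)| < e].
Proof.
move=> dT x e e0; pose B := [set y : E | `|x - y| < e].
pose S := [set y : E | exists2 g, g \in G & B (y + g)].
have oS : open S.
  apply/open_normP => y [g gG]; rewrite /B /= => yg.
  exists (e - `|x - (y + g)|); first by rewrite subr_gt0.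
  move=> z yz; exists g => //=; have := ler_normD (x - (y + g)) (y - z).
  have -> : x - (y + g) + (y - z) = x - (z + g).
    by rewrite opprD (addrC (- y)) (addrA x) subrKA opprD (addrC (- z)) (addrA x).
  by rewrite /B /=; move: yz => /=; lra.
have piS : torus_proj G @^-1` (torus_proj G @` S) = S.
  apply/seteqP; split=> [y [z [g gG Bz] /torus_projP zy]|y Sy]; last by exists y.
  exists (g + (z - y)); first by rewrite rpredD.
  by rewrite addrCA (addrC y) subrK addrC.
have [||t [[y [g gG By] <-] [v vE /torus_projP vy]]] := dT (torus_proj G @` S).
- by exists (torus_proj G x), x => //; exists 0; rewrite ?rpred0// /B /= addr0 subrr normr0.
- by rewrite /open /= /quotient_open; move: oS; rewrite -{1}piS.
exists v, (g + (y - v)); split=> //; first by rewrite rpredD// -opprB rpredN.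
by move: By; rewrite addrCA (addrC v) subrK addrC.
Qed.

End Torus.

(** * Uniqueness of the contracting subspace *)

Section Hyperbolic.
Variables (R : realType) (k : nat).
Local Notation E := 'rV[R]_k.
Implicit Types (U S : {vspace E}) (M : 'End(E)).

Lemma vsval_iter_restr U M m u : invariant_subspace M U ->
  vsval (iter m (restr U M) u) = iter m M (vsval u).
Proof. by move=> inv; elim: m => //= m IH; rewrite vsval_restr// IH. Qed.

Lemma contracting_orbit S M x (e : R) : invariant_subspace M S ->
  contractive (restr S M) -> x \in S -> 0 < e ->
  exists m0, forall m, (m0 <= m)%N -> `|iter m M x| < e.
Proof.
move=> inv cS xS e0; have [r r01 dec] := contractive_orbit_decay cS.
have [C C0 HC] := dec (Subvs xS).
have [m0 Hm0] := expr_inv_unbounded (C / e + 1) r01; exists m0 => m /Hm0 Hm.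
have -> : `|iter m M x| = `|iter m (restr S M) (Subvs xS)|.
  by rewrite -[x]/(vsval (Subvs xS)) -vsval_iter_restr.
apply: le_lt_trans (HC m) _.
have rm : 0 < r ^+ m by rewrite exprn_gt0//; case/andP: r01.
rewrite -ltr_pdivlMr//; apply: lt_le_trans (_ : e * (C / e + 1) <= _).
  by rewrite mulrDr mulr1 mulrCA divff ?gt_eqF// mulr1 ltrDl.
by rewrite ler_wpM2l// ltW.
Qed.

Lemma contracting_orbit_bounded S M x : invariant_subspace M S ->
  contractive (restr S M) -> x \in S -> exists B : R, forall m, `|iter m M x| <= B.
Proof.
move=> inv cS xS; have [r /andP[r0 r1] dec] := contractive_orbit_decay cS.
have [C C0 HC] := dec (Subvs xS); exists C => m.
have -> : `|iter m M x| = `|iter m (restr S M) (Subvs xS)|.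
  by rewrite -[x]/(vsval (Subvs xS)) -vsval_iter_restr.
apply: le_trans (HC m) _; rewrite ler_piMr// exprn_ile1// ltW//.
Qed.

(** In a norm adapted to the inverse, [N u] is at most [r ^+ m] times [N] of the [m]-th iterate, so
    a bounded orbit gives [N u = 0]. *)
Lemma expanding_orbit_bounded U M x (B : R) : invariant_subspace M U ->
  expansive (restr U M) -> x \in U -> (forall m, `|iter m M x| <= B) -> x = 0.
Proof.
move=> inv eU xU xB; have kU := expansive_lker0 eU.
have [N [r [C [r01 C0 NB NL Nn]]]] := contractive_adapted_norm (expansive_inv_contractive eU).
pose u := Subvs xU.
have itB m : `|iter m (restr U M) u| <= B.
  by have := xB m; rewrite -[x]/(vsval u) -vsval_iter_restr.
have Nit m : N u <= r ^+ m * N (iter m (restr U M) u).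
  elim: m => [|m IH]; first by rewrite expr0 mul1r.
  apply: le_trans IH _; rewrite exprSr -mulrA ler_wpM2l//.
    by rewrite exprn_ge0//; case/andP: r01 => /ltW.
  by have := NL (iter m.+1 (restr U M) u); rewrite /= lker0_lfunK.
have Nu m : N u * (r ^+ m)^-1 <= C * B.
  have rm : 0 < r ^+ m by rewrite exprn_gt0//; case/andP: r01.
  rewrite ler_pdivrMr// [leRHS]mulrC; apply: le_trans (Nit m) _; rewrite ler_wpM2l ?(ltW rm)//.
  have /andP[_ H] := Nn (iter m (restr U M) u); apply: le_trans H _.
  by rewrite ler_wpM2l.
have [u0 _] := andP (Nn u).
suff : N u <= 0.
  move=> N0; have : `|u| = 0 by apply/le_anti; rewrite normr_ge0 andbT (le_trans u0 N0).
  by move/normr0_eq0 => u00; rewrite -[x]/(vsval u) u00 linear0.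
rewrite leNgt; apply/negP => N0.
have [m0 Hm0] := expr_inv_unbounded ((C * B + 1) / N u) r01.
have := Hm0 m0 (leqnn _); rewrite ler_pdivrMr// mulrC; have := Nu m0; lra.
Qed.

Lemma expanding_contracting_cap U S M : invariant_subspace M U ->
  expansive (restr U M) -> invariant_subspace M S -> contractive (restr S M) ->
  (U :&: S)%VS = 0%VS.
Proof.
move=> iU eU iS cS; apply/eqP; rewrite -subv0; apply/subvP => x.
rewrite memv_cap => /andP[xU xS]; have [B HB] := contracting_orbit_bounded iS cS xS.
by rewrite (expanding_orbit_bounded iU eU xU HB) mem0v.
Qed.

(** Vectors of a contracting subspace have bounded forward orbits, which forces their expanding
    component in any other splitting to vanish. *)
Lemma contracting_subspace_sub M S S' :
  contracting_subspace M S -> contracting_subspace M S' -> (S <= S')%VS.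
Proof.
move=> [U [_ [_ iS] _ cS]] [U' [US' [iU' iS'] eU' cS']].
apply/subvP => x xS.
have /memv_addP[u uU [s sS xE]] : x \in (U' + S')%VS by rewrite US' memvf.
have [B HB] := contracting_orbit_bounded iS cS xS.
have [B' HB'] := contracting_orbit_bounded iS' cS' sS.
rewrite xE (expanding_orbit_bounded (B := B + B') iU' eU' uU) ?add0r// => m.
have -> : u = x - s by rewrite xE addrK.
rewrite iter_raddfB; apply: le_trans (ler_normB _ _) _; exact: lerD.
Qed.

Lemma contracting_subspace_unique M S S' :
  contracting_subspace M S -> contracting_subspace M S' -> S = S'.
Proof.
move=> cS cS'; apply/eqP; rewrite eqEsubv.
by rewrite (contracting_subspace_sub cS cS') (contracting_subspace_sub cS' cS).
Qed.

End Hyperbolic.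

(** The boundary of a closed set has empty interior. A ball missing the set would be sent by [p - f]
    onto a neighbourhood inside [K] that avoids the interior of [K]. *)
Lemma generic_point_open_dense (R : realType) (H : normedModType R) (K : set H)
    (f f' : H -> H) (c c' : R) (p : H) :
  cancel f f' -> cancel f' f -> 0 <= c -> 0 <= c' ->
  (forall x y, `|f x - f y| <= c * `|x - y|) ->
  (forall x y, `|f' x - f' y| <= c' * `|x - y|) -> closed K ->
  open [set x | interior K (p - f x) \/ ~ K (p - f x)] /\
  dense [set x | interior K (p - f x) \/ ~ K (p - f x)].
Proof.
move=> fK f'K c0 c'0 Hc Hc' cK.
have c1 : 0 < c + 1 by rewrite ltr_wpDl.
have c'1 : 0 < c' + 1 by rewrite ltr_wpDl.
have dE (z x y : H) : z - x - (z - y) = y - x by rewrite opprB addrC addrA subrK.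
split.
  have oK : open (interior K `|` ~` K) by apply: openU; [exact: open_interior|exact: closed_openC].
  apply/open_normP => x /= Ox; move/open_normP: oK => /(_ _ Ox)[e e0 He].
  exists (e / (c + 1)); first exact: divr_gt0.
  move=> y; rewrite ltr_pdivlMr// => xy; apply: He; rewrite dE.
  apply: le_lt_trans (Hc y x) _; rewrite distrC.
  have := normr_ge0 (x - y); nra.
apply/dense_normP => x e e0; apply: contrapT => noy.
have allK y : `|x - y| < e -> K (p - f y) /\ ~ interior K (p - f y).
  move=> xy; split; apply: contrapT => H1; apply: noy; exists y => //=; first by right.
  by left; apply: contrapT.
have [|_] := allK x; first by rewrite subrr normr0.
apply.
apply/interior_normP; exists (e / (c' + 1)); first exact: divr_gt0.
move=> w; rewrite ltr_pdivlMr// => xw.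
have [|] := allK (f' (p - w)); last by rewrite f'K subKr.
rewrite -{1}(fK x); apply: le_lt_trans (Hc' _ _) _.
have -> : `|f x - (p - w)| = `|p - f x - w| by rewrite distrC addrAC.
have := normr_ge0 (p - f x - w); nra.
Qed.

(** * The scheme and the window attached to a hyperbolic automorphism *)

Section FromHyperbolic.
Variables (R : realType) (k : nat) (Ev Ei : {vspace 'rV[R]_k}) (G : zmodClosed 'rV[R]_k).
Local Notation E := 'rV[R]_k.
Local Notation pv := (phys_proj Ev Ei).
Local Notation ph := (int_proj Ev Ei).
Hypothesis dim_Ev : (0 < \dim Ev)%N.
Hypothesis latG : full_rank_lattice G.
Hypothesis dense_Ev : dense (torus_proj G @` [set` Ev]).
Hypothesis G_Ev : [set` G] `&` [set` Ev] = [set 0].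

(** Baire category over countably many conditions, two for each vector of integer coordinates. It is
    applied to the inverse of the contraction, giving the shifts of a pattern and of its partner
    together. *)
Lemma generic_shifts_exist (K : set (subvs_of Ei)) (A : 'End(subvs_of Ei)) :
  closed K -> lker A == 0%VS ->
  exists s, generic_shift G ph (fun _ : 'I_1 => K) s /\
            generic_shift G ph (fun _ : 'I_1 => K) (A s).
Proof.
move=> cK kA; have [b bb HG] := latG.
have [c c0 Hc] := @subspace_linear_bounded R k Ei (subvs_of Ei) A.
have [c' c'0 Hc'] := @subspace_linear_bounded R k Ei (subvs_of Ei) (A^-1)%VF.
pose g (a : {ffun 'I_(\dim {:E}) -> int}) : E := \sum_(i < \dim {:E}) b`_i *~ a i.
pose T (u : bool) (s : subvs_of Ei) := if u then A s else s.
pose good (ua : bool * {ffun 'I_(\dim {:E}) -> int}) : set (subvs_of Ei) :=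
  [set s | interior K (ph (g ua.2) - T ua.1 s) \/ ~ K (ph (g ua.2) - T ua.1 s)].
have LA x y : `|A x - A y| <= c * `|x - y| by rewrite -linearB; exact: Hc.
have LA' x y : `|(A^-1)%VF x - (A^-1)%VF y| <= c' * `|x - y|.
  by rewrite -linearB; exact: Hc'.
have L1 (x y : subvs_of Ei) : `|id x - id y| <= 1 * `|x - y| by rewrite mul1r.
have idK : cancel id (@id (subvs_of Ei)) by [].
have od ua : open (good ua) /\ dense (good ua).
  case: ua => -[] a; rewrite /good /T /=.
    exact: (@generic_point_open_dense R _ K _ _ _ _ _ (lker0_lfunK kA) (lker0_lfunVK kA) c0 c'0 LA LA' cK).
  exact: (@generic_point_open_dense R _ K _ _ _ _ _ idK idK ler01 ler01 L1 L1 cK).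
have [|s Hs] := @subspace_Baire R k Ei
  (fun m => if unpickle m is Some ua then good ua else setT).
  move=> m; case: unpickle => [ua|]; first exact: od.
  split; first exact: openT.
  by move=> O [x Ox] _; exists x.
have good_s u h : h \in G -> interior K (ph h - T u s) \/ ~ K (ph h - T u s).
  move=> /HG[a aE]; have := Hs (pickle (u, [ffun i => a i])); rewrite pickleK /good /=.
  suff -> : g [ffun i => a i] = h by [].
  by rewrite aE; apply: eq_bigr => i _; rewrite ffunE.
by exists s; split=> i h hG; rewrite -(closure_id K).1//;
  [exact: (good_s false)|exact: (good_s true)].
Qed.

Variable M : 'End(E).
Hypothesis datum : hyperbolic_datum Ev G M.
Hypothesis contracting : contracting_subspace M Ei.

(** A lattice vector in [Ei] has an orbit in the discrete [G] tending to 0, so it vanishes; one in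
    [Ev] vanishes by assumption, which also excludes [Ei = 0]. Density in [Ei] is that of [Ev + G],
    projected. *)
Lemma hyperbolic_scheme : cut_project_scheme Ev Ei G.
Proof.
case: datum => hM MG iv eM [S cS sumS].
rewrite (contracting_subspace_unique cS contracting) in sumS.
have [U [_ [_ ii] _ cM]] := contracting.
have cap0 := expanding_contracting_cap iv eM ii cM.
have iterG m g : g \in G -> iter m M g \in G.
  move=> gG; elim: m => //= m IH.
  have : [set` G] (M (iter m M g)) by rewrite -MG; exists (iter m M g).
  by [].
have kM : lker M == 0%VS.
  by apply/lker0P/bij_inj; case: hM.
split=> //.
- rewrite lt0n; apply/negP => /eqP dEi.
  have Ei0 : Ei = 0%VS by apply/eqP; rewrite -dimv_eq0 dEi.
  have [b bb HG] := latG.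
  have EvT : Ev = fullv by rewrite -sumS Ei0 addv0.
  have dE : (0 < \dim {:E})%N by rewrite -EvT.
  have bG : [set` G] b`_0.
    apply/HG; exists (fun j => (j == Ordinal dE)%:Z).
    rewrite (bigD1 (Ordinal dE))//= ?eqxx mulr1z big1 ?addr0// => j /negPf ->.
    by rewrite mulr0z.
  have b0 : b`_0 = 0.
    suff : [set (0 : E)] b`_0 by [].
    by rewrite -G_Ev; split=> //=; rewrite EvT memvf.
  have b0b : b`_0 \in (b : seq E) by rewrite mem_nth// size_tuple.
  by have := free_not0 (basis_free bb) b0b; rewrite b0 eqxx.
- move=> g h gG hG gh; apply/eqP; rewrite -subr_eq0; apply/negPn/negP => d0.
  have dG : g - h \in G by rewrite rpredB.
  have dEi : g - h \in Ei.
    have pv0 : pv (g - h) = 0 by rewrite linearB /= gh subrr.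
    by rewrite -(proj_sum sumS cap0 (g - h)) pv0 linear0 add0r subvsP.
  have [F HF] := lattice_finite latG 1.
  have [||e e0 He] := @seq_common_radius R _ F (fun g e => g \in G -> g != 0 -> e <= `|g|).
  + by move=> x d e de Hx xG x0; exact: le_trans de (Hx xG x0).
  + move=> x _; have [->|x0] := eqVneq x 0; first by exists 1; rewrite ?eqxx.
    by exists `|x|; rewrite ?normr_gt0.
  have e1 : 0 < Num.min e 1 by rewrite lt_min e0 ltr01.
  have [m Hm] := contracting_orbit ii cM dEi e1.
  have := Hm m (leqnn _); rewrite lt_min => /andP[le1 le2].
  suff /He : iter m M (g - h) \in F.
    move=> /(_ (iterG m _ dG)) H; have : iter m M (g - h) != 0.
      apply: contra d0 => /eqP it0; apply/eqP.
      apply: (can_inj (iter_cancel m (lker0_lfunK kM))).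
      by rewrite it0; elim: (m) => //= j <-; rewrite linear0.
    by move=> /H; rewrite leNgt le1.
  by apply: HF; [exact: iterG|exact: ltW].
- move=> g h gG hG gh; apply/eqP; rewrite -subr_eq0.
  suff : [set (0 : E)] (g - h) by move=> ->.
  rewrite -G_Ev; split=> /=; first by rewrite rpredB.
  have ph0 : ph (g - h) = 0 by rewrite linearB /= gh subrr.
  by rewrite -(proj_sum sumS cap0 (g - h)) ph0 linear0 addr0 subvsP.
- have [c c0 Hc] := row_linear_bounded ph.
  have c1 : 0 < c + 1 by rewrite ltr_wpDl.
  apply/dense_normP => h e e0; have e1 : 0 < e / (c + 1) by rewrite divr_gt0.
  have [v [g [vE gG]]] := torus_dense dense_Ev (vsval h) e1.
  rewrite ltr_pdivlMr// => vg; exists (ph g); first by exists g.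
  have := Hc (vsval h - (v + g)); rewrite linearB linearD /= int_proj_int//.
  have -> : ph v = 0 by apply: (int_proj_phys sumS cap0 (Subvs vE)).
  rewrite add0r => /le_lt_trans; apply.
  have := normr_ge0 (vsval h - (v + g)); nra.
Qed.


Lemma hyperbolic_window : exists (l : nat) (W : 'I_l -> set (subvs_of Ei)) (Z : set E),
  [/\ substitutional_datum G (restr Ev M) W, finite_set Z, Z `<=` [set` G]
    & forall i : 'I_l, W i = \bigcup_(z in Z)
        translate (restr Ei M @` W i) (int_proj Ev Ei z)].
Proof.
have scheme := hyperbolic_scheme.
case: datum => hM MG iv eM _; have [U [_ [_ ii] _ cM]] := contracting.
have [sumE capE] := scheme_complementary scheme.
have LS := scheme_lattice_scheme sumE capE scheme.
have kM : lker M == 0%VS by apply/lker0P/bij_inj; case: hM.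
have kL := expansive_lker0 eM.
set L := restr Ev M in eM kL *; set A := restr Ei M in cM *.
have kA : lker A == 0%VS.
  apply/lker0P => x y xy; apply: (can_inj (@vsvalK _ _ _)); apply: (lker0P kM).
  by rewrite -!vsval_restr// -/A xy.
have pvM x : pv (M x) = L (pv x).
  rewrite -{1}(proj_sum sumE capE x) !linearD /= -!vsval_restr//.
  by rewrite phys_proj_phys// phys_proj_int// addr0.
have phM x : ph (M x) = A (ph x).
  rewrite -{1}(proj_sum sumE capE x) !linearD /= -!vsval_restr//.
  by rewrite int_proj_phys// int_proj_int// add0r.
have MK := lker0_lfunK kM; have M'K := lker0_lfunVK kM.
have LK := lker0_lfunK kL; have L'K := lker0_lfunVK kL.
have AK := lker0_lfunK kA; have A'K := lker0_lfunVK kA.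
have MGl g : g \in G -> M g \in G.
  move=> gG; have : [set` G] (M g) by rewrite -MG; exists g.
  by [].
have M'Gl g : g \in G -> (M^-1)%VF g \in G.
  move=> gG; have : (M @` [set` G]) g by rewrite MG.
  by move=> [h hG <-]; rewrite MK.
have pvM' x : pv ((M^-1)%VF x) = (L^-1)%VF (pv x).
  by rewrite -{2}(M'K x) pvM LK.
have [N [r [C [r01 C0 NB NA Nn]]]] := contractive_adapted_norm cM.
have [N' [r' [C' [r01' C0' NB' NL' Nn']]]] :=
  contractive_adapted_norm (expansive_inv_contractive eM).
have [c c0 Hc] := @subspace_linear_bounded R k Ei (subvs_of Ei) (A^-1)%VF.
have [Z [K [ZG rK Kinv]]] := self_affine_window LS AK A'K c0 Hc r01 C0 NB NA Nn.
have clK : closed K by case: rK => _ -> _; exact: closed_closure.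
have kA' : lker (A^-1)%VF == 0%VS.
  by apply/lker0P; apply: can_inj A'K.
have [s [gs gs']] := generic_shifts_exist clK kA'.
have [cK Kreg K0] := rK.
have [rho Hrho] := compact_norm_bounded cK.
pose W := fun _ : 'I_1 => K.
have W_bnd (i : 'I_1) h : W i h -> `|h| <= rho := Hrho h.
have intK : interior (W ord0) !=set0.
  by have [x Kx] := K0; have [y Ky _] := regular_interior rK Kx ltr01; exists y.
exists 1%N, W, [set` Z]; split=> [|||i]; last first.
- rewrite /W {1}Kinv; apply/seteqP; split=> x [z zZ Kz]; exists z => //.
    by apply/translateE; exists ((A^-1)%VF (x - ph z)); rewrite ?A'K.
  by move/translateE: Kz => [y Ky yE]; change (K ((A^-1)%VF (x - int_proj Ev Ei z))); rewrite -yE AK.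
- by move=> z /ZG.
- exact: finite_seq.
have winW : is_window W by split=> //; exists ord0.
have deloneP t : delone (model_set G pv ph W t) :=
  model_set_delone LS W_bnd t intK.
have LIP t t' : generic_shift G ph W t ->
    LI (model_set G pv ph W t) (model_set G pv ph W t') :=
  fun gt => model_set_LI LS W_bnd t' gt.
have A'B x : (A^-1)%VF (A x - s) = x - (A^-1)%VF s by rewrite linearB [X in X - _]AK.
(* The shift [A^-1 s] of the partner is chosen so that its image under [L] has window [A K] with the
   original shift [s]. *)
have imE : image_multiset L (model_set G pv ph W ((A^-1)%VF s)) =
    model_set G pv ph (fun _ => [set x | K ((A^-1)%VF x)]) s.
  apply/funext => i; apply/seteqP; split=> [_ [_ [g [gG Kg] <-] <-]|_ [g [gG Kg] <-]].
    exists (M g); last exact: pvM.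
    by split; [exact: MGl|rewrite /= phM A'B].
  exists (pv ((M^-1)%VF g)); last exact: etrans (esym (pvM _)) (congr1 pv (M'K g)).
  exists ((M^-1)%VF g) => //; split; first exact: M'Gl.
  by rewrite /W -A'B -phM M'K.
split=> //; exists (model_set G pv ph W s).
  exists s; split; first exact/nonsingular_generic.
  by rewrite cut_project_model_set; split=> //; exact: LIP.
split; first exact: lker0_bijective.
exists (model_set G pv ph W ((A^-1)%VF s)); split=> //.
  by split; exact: LIP.
rewrite imE.
exact: (window_image_MLD LS MK M'K MGl M'Gl AK A'K phM pvM' c0 Hc r01' NB' NL' Nn' ZG rK Kinv).
Qed.

End FromHyperbolic.

Theorem theorem3p3 (R : realType) (k : nat)
  (Ev : {vspace 'rV[R]_k}) (G : zmodClosed 'rV[R]_k)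
  (dim_Ev : (0 < \dim Ev)%N)
  (latG : full_rank_lattice G)
  (dense_Ev : dense (torus_proj G @` [set` Ev]))
  (G_Ev : [set` G] `&` [set` Ev] = [set 0]) :
  [/\ (exists (Ei : {vspace 'rV[R]_k}) (L : 'End(subvs_of Ev))
          (l : nat) (W : 'I_l -> set (subvs_of Ei)),
         substitutional_datum G L W)
      <->
      (exists M : 'End('rV[R]_k), hyperbolic_datum Ev G M),
      forall (Ei : {vspace 'rV[R]_k}) (L : 'End(subvs_of Ev))
          (l : nat) (W : 'I_l -> set (subvs_of Ei)),
        substitutional_datum G L W ->
        exists M : 'End('rV[R]_k),
          [/\ hyperbolic_datum Ev G M, L = restr Ev M
            & contracting_subspace M Ei]
    & forall (M : 'End('rV[R]_k)) (Ei : {vspace 'rV[R]_k}),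
        hyperbolic_datum Ev G M -> contracting_subspace M Ei ->
        exists (l : nat) (W : 'I_l -> set (subvs_of Ei))
            (Z : set 'rV[R]_k),
          [/\ substitutional_datum G (restr Ev M) W,
              finite_set Z, Z `<=` [set` G]
            & forall i : 'I_l,
                W i = \bigcup_(z in Z)
                        translate (restr Ei M @` W i) (int_proj Ev Ei z)]].
Proof.
split.
- split=> [[Ei [L [l [W datum]]]]|[M datum]].
    by have [M [hM _ _]] := substitution_hyperbolic datum; exists M.
  have [_ _ _ _ [S cS _]] := datum.
  have [l [W [Z [sd _ _ _]]]] := hyperbolic_window dim_Ev latG dense_Ev G_Ev datum cS.
  by exists S, (restr Ev M), l, W.
- by move=> Ei L l W; exact: substitution_hyperbolic.
- by move=> M Ei; exact: hyperbolic_window.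
Qed.
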